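(* Let $m\geq 2$. Given $\mathbf{a}=(a_1,\dots,a_m)\in(\mathbb{C}^\times)^m$ and $\mathcal{S}\subset\{1,\dots,m\}$, define matrices $E_{i\bar 1},E_{\bar 1 i}\in\mathrm{Mat}_2(\mathbb{C}[\mathbf{h}])$ by $$E_{i\bar{1}} = \begin{bmatrix} 0 & a_i h_i \\ 0 & 0 \end{bmatrix},\quad E_{\bar{1}i} = \begin{bmatrix} 0 & 0 \\ a_i^{-1} & 0 \end{bmatrix} \quad\text{if } i \in \mathcal{S};\qquad E_{i\bar{1}} = \begin{bmatrix} 0 & a_i \\ 0 & 0 \end{bmatrix},\quad E_{\bar{1}i} = \begin{bmatrix} 0 & 0 \\ a_i^{-1} h_{i} & 0 \end{bmatrix} \quad\text{if } i \notin \mathcal{S}.$$ Then these matrices determine a $\mathcal{U}(\mathfrak{sl}(m|1))$-module structure on $\mathbb{C}[\mathbf{h}]^{\oplus 2}$, denoted $M(\mathbf{a},\mathcal{S})$, in which $h_i$ acts by multiplication and, for all $i\in\{1,\dots,m\}$ and $\mathbf{f}\in\mathbb{C}[\mathbf{h}]^{\oplus 2}$, $$e_{i\bar 1}\cdot\mathbf{f}=E_{i\bar 1}\,\Delta_i^{-1}(\mathbf{f}),\qquad e_{\bar 1 i}\cdot\mathbf{f}=E_{\bar 1 i}\,\Delta_i(\mathbf{f}).$$ Moreover, if $M\in\mathcal{M}_{\mathfrak{sl}(m|1)}(2)$, then $M\simeq M(\mathbf{a},\mathcal{S})$ for some $\mathbf{a}\in(\mathbb{C}^\times)^m$ and $\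mathcal{S}\subset\{1,\dots,m\}$.
   Context: Everything is over $\mathbb{C}$. $\mathfrak{sl}(m|1)$ is the Lie superalgebra of supertraceless $(m+1)\times(m+1)$ matrices with rows and columns indexed by $\{1,\dots,m\}\cup\{\bar 1\}$; $e_{IJ}$ are the matrix units, with $e_{ij}$ even and $e_{i\bar 1},e_{\bar 1 i}$ odd, and $[x,y]=xy-(-1)^{|x||y|}yx$. Put $h_i=e_{ii}+e_{\bar 1\bar 1}$ for $1\le i\le m$; these span the Cartan subalgebra $\mathfrak{h}$, and $\mathcal{U}(\mathfrak{h})=\mathbb{C}[\mathbf{h}]=\mathbb{C}[h_1,\dots,h_m]$. For $1\le i\le m$, $\sigma_i$ is the $\mathbb{C}$-algebra automorphism of $\mathbb{C}[\mathbf{h}]$ with $\sigma_i(h_i)=h_i-1$ and $\sigma_i(h_j)=h_j$ for $j\ne i$; $\Delta=\sigma_1\cdots\sigma_m$ and $\Delta_i=\sigma_i^{-1}\Delta$. Automorphisms act entrywise on vectors and matrices. $\mathcal{U}(\mathfrak{sl}(m|1))$ is viewed as an ungraded associative algebra, so a module is a vector space on which $[x,y]$ acts as $xy-(-1)^{|x||y|}yx$ for homogeneous $x,y\in\mathfrak{sl}(m|1)$. $\mathcal{M}_{\mathfrak{sl}(m|1)}(2)$ is the category of such (not necessarily $\mathbb{Z}_2$-graded) modules whose restriction to $\mathcal{U}(\mathfrak{h})$ is free of rank 2; $\simeq$ means isomorphism of $\mathcal{U}(\mathfrak{sl}(m|1))$-modules. Since the elements $e_{i\bar 1},e_{\bar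 1 i}$ generate $\mathfrak{sl}(m|1)$, their action determines the module. *)

(* Defs.v *)
From HB Require Import structures.
From mathcomp Require Import all_boot all_order all_algebra.
From mathcomp Require Import reals complex mpoly ring.

Set Implicit Arguments.
Unset Strict Implicit.
Unset Printing Implicit Defensive.

Import GRing.Theory.
Local Open Scope ring_scope.

(* Rows and columns of 'M_(m + 1) are indexed by {1, ..., m} (via lshift) and
   by the single odd index \bar 1 (via rshift). *)
Section SuperMatrices.
Variables (F : fieldType) (m : nat).
Implicit Types X Y : 'M[F]_(m + 1).

Definition ev (i : 'I_m) : 'I_(m + 1) := lshift 1 i.
Definition od : 'I_(m + 1) := rshift m ord0.

Definition str X : F := \tr (ulsubmx X) - \tr (drsubmx X).

(* parity component: false = even, true = odd *)
Definition part (p : bool) X : 'M[F]_(m + 1) :=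
  if p then block_mx 0 (ursubmx X) (dlsubmx X) 0
  else block_mx (ulsubmx X) 0 0 (drsubmx X).

Definition has_parity (p : bool) X : Prop := part p X = X.

(* bilinear extension of [x, y] = x y - (-1)^(|x||y|) y x *)
Definition mx_sbracket X Y : 'M[F]_(m + 1) :=
  \sum_(p : bool) \sum_(q : bool)
    (part p X *m part q Y - (-1) ^+ (p && q) *: (part q Y *m part p X)).

Lemma part_parity p q X : has_parity p X -> part q X = if p == q then X else 0.
Proof.
move=> <-; case: p q => [] [] //=;
  rewrite /part ?(block_mxKul, block_mxKur, block_mxKdl, block_mxKdr) //;
  exact: block_mx0.
Qed.

Lemma mx_sbracketE p q X Y : has_parity p X -> has_parity q Y ->
  mx_sbracket X Y = X *m Y - (-1) ^+ (p && q) *: (Y *m X).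
Proof.
move=> hX hY; rewrite /mx_sbracket !big_bool !(part_parity _ hX) !(part_parity _ hY).
by case: {hX} p; case: {hY} q => /=;
  rewrite ?mul0mx ?mulmx0 ?scaler0 ?subr0 ?addr0 ?add0r.
Qed.

Fact str_linear : scalar str.
Proof.
move=> c X Y; rewrite /str /ulsubmx /drsubmx !(linearD, linearZ) /=.
by rewrite mulrBr opprD addrACA.
Qed.

Lemma str_sbracket X Y : str (mx_sbracket X Y) = 0.
Proof.
rewrite /mx_sbracket !big_bool /= !mulmx_block !scale_block_mx.
rewrite !opp_block_mx !add_block_mx /str block_mxKul block_mxKdr.
rewrite !(mul0mx, mulmx0, addr0, add0r, scaler0, oppr0, subr0).
rewrite expr1 expr0 !scaleN1r !scale1r !opprK !raddfD !raddfN /=.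
rewrite (mxtrace_mulC (dlsubmx X)) (mxtrace_mulC (dlsubmx Y)).
rewrite (mxtrace_mulC (ulsubmx X)) (mxtrace_mulC (drsubmx X)).
ring.
Qed.

Definition sl_pred : {pred 'M[F]_(m + 1)} := fun X => str X == 0.

Fact sl_submod_closed : submod_closed sl_pred.
Proof.
split=> [|c X Y]; first by rewrite unfold_in /str /ulsubmx /drsubmx !linear0 subrr.
rewrite !unfold_in => /eqP X0 /eqP Y0.
by rewrite str_linear X0 Y0 mulr0 addr0.
Qed.
HB.instance Definition _ := GRing.isSubmodClosed.Build F 'M[F]_(m + 1) sl_pred
  sl_submod_closed.

(* sl(m|1) *)
Record sl := Sl { sl_val : 'M[F]_(m + 1); sl_valP : sl_val \in sl_pred }.
HB.instance Definition _ := [isSub for sl_val].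
HB.instance Definition _ := [Choice of sl by <:].
HB.instance Definition _ := [SubChoice_isSubLmodule of sl by <:].

Fact sbracket_subproof (x y : sl) : mx_sbracket (sl_val x) (sl_val y) \in sl_pred.
Proof. by rewrite unfold_in str_sbracket. Qed.
Definition sbracket (x y : sl) : sl := Sl (sbracket_subproof x y).

Lemma str_ev_od i : str (delta_mx (ev i) od) = 0.
Proof.
rewrite /str /mxtrace !big1 ?subrr // => k _; rewrite !mxE.
  by rewrite eq_rlshift.
by rewrite eq_lrshift andbF.
Qed.

Lemma str_od_ev i : str (delta_mx od (ev i)) = 0.
Proof.
rewrite /str /mxtrace !big1 ?subrr // => k _; rewrite !mxE.
  by rewrite eq_rlshift andbF.
by rewrite eq_lrshift.
Qed.

Lemma str_h i : str (delta_mx (ev i) (ev i) + delta_mx od od) = 0.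
Proof.
rewrite /str /mxtrace big_ord1 (bigD1 i) //= big1 => [|k ki]; rewrite !mxE.
  by rewrite !eqxx eq_lrshift eq_rlshift !addr0 add0r subrr.
by rewrite eq_lshift eq_lrshift (negPf ki) addr0.
Qed.

Definition e_i1 (i : 'I_m) : sl := Sl (introT eqP (str_ev_od i)).
Definition e_1i (i : 'I_m) : sl := Sl (introT eqP (str_od_ev i)).
Definition h_ (i : 'I_m) : sl := Sl (introT eqP (str_h i)).

End SuperMatrices.

Section Modules.
Variables (F : fieldType) (m : nat).

(* U(sl(m|1))-module structures on V, not necessarily Z/2-graded *)
Record is_umodule (V : lmodType F) (rho : sl F m -> V -> V) : Prop := IsUmodule {
  umod_linearl : forall v, linear (rho^~ v);
  umod_linearr : forall x, linear (rho x);
  umod_bracket : forall (p q : bool) (x y : sl F m) (v : V),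
    has_parity p (sl_val x) -> has_parity q (sl_val y) ->
    rho (sbracket x y) v
      = rho x (rho y v) - (-1) ^+ (p && q) *: rho y (rho x v)
}.

Definition umod_iso (V W : lmodType F)
    (rho : sl F m -> V -> V) (rho' : sl F m -> W -> W) : Prop :=
  exists phi : {linear V -> W},
    bijective phi /\ forall x v, phi (rho x v) = rho' x (phi v).

(* Action on V of the monomial prod_i h_i ^ (k i), and of a polynomial, i.e. of
   an element of U(h) = C[h_1, ..., h_m]; the h_i act by commuting operators. *)
Definition Uh_monom (V : lmodType F) (rho : sl F m -> V -> V)
    (k : 'X_{1..m}) (v : V) : V :=
  foldr (fun i w => iter (k i) (rho (h_ F i)) w) v (enum 'I_m).

Definition Uh_act (V : lmodType F) (rho : sl F m -> V -> V)
    (p : {mpoly F[m]}) (v : V) : V :=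
  \sum_(k <- msupp p) p@_k *: Uh_monom rho k v.

Definition Uh_free (V : lmodType F) (rho : sl F m -> V -> V) (r : nat) : Prop :=
  exists b : 'I_r -> V, forall v : V,
    exists! f : {ffun 'I_r -> {mpoly F[m]}}, v = \sum_(i < r) Uh_act rho (f i) (b i).

(* the category M_{sl(m|1)}(r) *)
Definition in_M (r : nat) (V : lmodType F) (rho : sl F m -> V -> V) : Prop :=
  is_umodule rho /\ Uh_free rho r.

End Modules.

Section Shifts.
Variables (F : fieldType) (m : nat).
Implicit Types (i : 'I_m) (p : {mpoly F[m]}).

(* the algebra endomorphism h_j |-> h_j + c_j *)
Definition shift (c : 'I_m -> F) p : {mpoly F[m]} :=
  p \mPo [tuple 'X_j + (c j)%:MP | j < m].

Definition sigma i : {mpoly F[m]} -> {mpoly F[m]} :=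
  shift (fun j => - (j == i)%:R).
Definition sigmaV i : {mpoly F[m]} -> {mpoly F[m]} :=
  shift (fun j => (j == i)%:R).

Definition Delta : {mpoly F[m]} -> {mpoly F[m]} :=
  \big[(fun f g => f \o g)/id]_(i < m) sigma i.
Definition DeltaV : {mpoly F[m]} -> {mpoly F[m]} :=
  \big[(fun f g => f \o g)/id]_(i < m) sigmaV i.

Definition Delta_ i : {mpoly F[m]} -> {mpoly F[m]} := sigmaV i \o Delta.
(* the inverse of Delta_ i; see Delta_K and Delta_VK *)
Definition Delta_V i : {mpoly F[m]} -> {mpoly F[m]} := DeltaV \o sigma i.

Lemma shiftX c j : shift c 'X_j = 'X_j + (c j)%:MP.
Proof. by rewrite /shift comp_mpolyXU -tnth_nth tnth_mktuple. Qed.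

Lemma shift_shift c d p : shift c (shift d p) = shift (fun j => c j + d j) p.
Proof.
rewrite /shift (comp_mpolyEX p) (comp_mpolyEX p) linear_sum /=.
apply: eq_bigr => k _; rewrite comp_mpolyZ; congr (_ *: _).
rewrite !comp_mpolyX rmorph_prod; apply: eq_bigr => i _ /=.
rewrite rmorphXn /= !tnth_mktuple; congr (_ ^+ _).
rewrite rmorphD /= comp_mpolyXU -tnth_nth tnth_mktuple comp_mpolyC.
by rewrite -addrA -mpolyCD.
Qed.

Lemma eq_shift c d : c =1 d -> shift c =1 shift d.
Proof.
move=> cd p; rewrite /shift; congr (_ \mPo _).
by apply: eq_from_tnth => j; rewrite !tnth_mktuple cd.
Qed.

Lemma shift0 c : c =1 (fun=> 0) -> shift c =1 id.
Proof.
move=> c0 p; rewrite /shift.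
rewrite -[RHS]comp_mpoly_id; congr (_ \mPo _).
by apply: eq_from_tnth => j; rewrite !tnth_mktuple c0 mpolyC0 addr0.
Qed.

Lemma big_shift (I : Type) (r : seq I) (c : I -> 'I_m -> F) :
  \big[(fun f g => f \o g)/id]_(i <- r) shift (c i)
    =1 shift (fun j => \sum_(i <- r) c i j).
Proof.
elim: r => [|i r IH] p.
  by rewrite big_nil shift0 // => j; rewrite big_nil.
rewrite big_cons /= IH shift_shift; apply: eq_shift => j.
by rewrite big_cons.
Qed.

Lemma Delta_K i : cancel (Delta_ i) (Delta_V i).
Proof.
move=> p; rewrite /Delta_ /Delta_V /= /Delta /DeltaV /sigma /sigmaV !big_shift !shift_shift.
by rewrite shift0 // => j; rewrite sumrN; ring.
Qed.

Lemma Delta_VK i : cancel (Delta_V i) (Delta_ i).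
Proof.
move=> p; rewrite /Delta_ /Delta_V /= /Delta /DeltaV /sigma /sigmaV !big_shift !shift_shift.
by rewrite shift0 // => j; rewrite sumrN; ring.
Qed.

End Shifts.

(* C[h]^2 as a vector space over C: the library only makes 'cV[A]_2 an
   A-module, hence the alias. *)
Section PolyVec.
Variables (F : fieldType) (m : nat).

Definition polyvec := 'cV[{mpoly F[m]}]_2.
HB.instance Definition _ := GRing.Zmodule.on polyvec.

Definition polyvec_scale (c : F) (f : polyvec) : polyvec :=
  map_mx (fun p => c *: p) f.

Fact polyvec_scaleA c d f :
  polyvec_scale c (polyvec_scale d f) = polyvec_scale (c * d) f.
Proof. by apply/matrixP => i j; rewrite !mxE scalerA. Qed.
Fact polyvec_scale1 : left_id 1 polyvec_scale.
Proof. by move=> f; apply/matrixP => i j; rewrite !mxE scale1r. Qed.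
Fact polyvec_scaleDr : right_distributive polyvec_scale +%R.
Proof. by move=> c f g; apply/matrixP => i j; rewrite !mxE scalerDr. Qed.
Fact polyvec_scaleDl f : {morph polyvec_scale^~ f : c d / c + d}.
Proof. by move=> c d; apply/matrixP => i j; rewrite !mxE scalerDl. Qed.
HB.instance Definition _ := GRing.Zmodule_isLmodule.Build F polyvec
  polyvec_scaleA polyvec_scale1 polyvec_scaleDr polyvec_scaleDl.

End PolyVec.

Section Mas.
Variables (F : fieldType) (m : nat) (a : 'I_m -> F) (S : {set 'I_m}).

Definition E_i1 (i : 'I_m) : 'M[{mpoly F[m]}]_2 :=
  (if i \in S then a i *: 'X_i else (a i)%:MP) *: delta_mx 0 1.

Definition E_1i (i : 'I_m) : 'M[{mpoly F[m]}]_2 :=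
  (if i \in S then ((a i)^-1)%:MP else (a i)^-1 *: 'X_i) *: delta_mx 1 0.

(* rho is the module structure of M(a, S) *)
Record is_Mas (rho : sl F m -> polyvec F m -> polyvec F m) : Prop := IsMas {
  Mas_umodule : is_umodule rho;
  Mas_h : forall i (f : 'cV[{mpoly F[m]}]_2), rho (h_ F i) f = 'X_i *: f;
  Mas_i1 : forall i f, rho (e_i1 F i) f = E_i1 i *m map_mx (Delta_V i) f;
  Mas_1i : forall i f, rho (e_1i F i) f = E_1i i *m map_mx (Delta_ i) f
}.

End Mas.

(* Main.v *)
(** Both [ker e_{i1}] and [ker e_{1i}] are saturated submodules of [C[h]^2].
    As the [e_{i1}] anticommute and square to zero, a semilinear [e_{j1}] maps
    the rank one kernel of [e_{i1}] to itself and hence vanishes there; so the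
    [e_{i1}] have a common kernel, and likewise the [e_{1i}].  Since [C[h]] is
    factorial, these kernels are [C[h] u] and [C[h] w].  The relation
    [e_{i1} e_{1i} + e_{1i} e_{i1} = h_i] shows that [h_i C[h]^2] lies in
    [C[h] u + C[h] w] for every [i], so [det (u, w)] divides [h_1 ^ 2] and
    [h_2 ^ 2]; it is therefore constant and [(u, w)] is a basis.  In it
    [e_{i1} w = p_i u] and [e_{1i} u = q_i w] with
    [p_i * Delta_i^{-1} (q_i) = h_i], so one of [p_i], [q_i] is constant.

    Conversely, since [{e_{i1}, e_{1j}} = e_{ij} + delta_{ij} e_{11}], the odd
    generators extend to an action of sl(m|1) as soon as they anticommute as
    required and the operators [{e_{i1}, e_{1j}}] bracket correctly with them. *)
Require Import Defs.
From HB Require Import structures.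
From mathcomp Require Import all_boot all_order all_algebra.
From mathcomp Require Import reals complex mpoly.
From mathcomp Require Import ssrcomplements ring zify.
From Stdlib Require Import Classical FunctionalExtensionality.

Set Implicit Arguments.
Unset Strict Implicit.
Unset Printing Implicit Defensive.

Import GRing.Theory.
Local Open Scope ring_scope.

(** * Polynomial rings are factorial *)

Section UniqueFactorization.

Definition divides (R : idomainType) (d x : R) := exists z, x = d * z.

Definition prime_elt (R : idomainType) (p : R) :=
  [/\ p != 0, p \isn't a GRing.unit &
      forall x y, divides p (x * y) -> divides p x \/ divides p y].

Inductive factors (R : idomainType) : R -> Prop :=
| factors_unit u : u \is a GRing.unit -> factors u
| factors_prime p x : prime_elt p -> factors x -> factors (p * x).

(** Factorizations are into prime, not merely irreducible, elements: uniqueness is then automatic,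
    and inductions can strip one prime at a time. *)
Definition factorial_ring (R : idomainType) :=
  forall x : R, x != 0 -> factors x.

Lemma divides_mulr (R : idomainType) (d x y : R) : divides d x -> divides d (x * y).
Proof. by case=> z ->; exists (z * y); rewrite mulrA. Qed.

Lemma divides_mull (R : idomainType) (d x y : R) : divides d y -> divides d (x * y).
Proof. by rewrite mulrC; apply: divides_mulr. Qed.

Lemma dividesD (R : idomainType) (d x y : R) :
  divides d x -> divides d y -> divides d (x + y).
Proof. by case=> [z ->] [t ->]; exists (z + t); rewrite mulrDr. Qed.

Lemma dividesB (R : idomainType) (d x y : R) :
  divides d x -> divides d y -> divides d (x - y).
Proof. by case=> [z ->] [t ->]; exists (z - t); rewrite mulrBr. Qed.

Lemma divides_trans (R : idomainType) (d x y : R) :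
  divides d x -> divides x y -> divides d y.
Proof. by move=> dx [z ->]; apply: divides_mulr. Qed.

Lemma factorsM (R : idomainType) (x y : R) : factors x -> factors y -> factors (x * y).
Proof.
move=> fx; elim: fx y => [u uu|p {}x pp fx IH] y fy; last first.
  by rewrite -mulrA; apply: factors_prime => //; apply: IH.
elim: fy => [v vv|p {}y pp fy IH].
  by apply: factors_unit; rewrite unitrM uu.
by rewrite mulrCA; apply: factors_prime.
Qed.

(** Write [p = q * z]. Primality of [p] makes it divide [q] or [z]; in the latter case cancelling
    [p] would make [q] a unit. *)
Lemma prime_divides_sym (R : idomainType) (p q : R) :
  prime_elt p -> prime_elt q -> divides q p -> divides p q.
Proof.
move=> [p0 up pp] [q0 uq pq] [z pE].
case: (pp q z); [by exists 1; rewrite mulr1 | by [] |].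
case=> t zE; case/negP: uq; apply/unitrP; exists t.
have: p * (q * t) = p * 1 by rewrite mulr1 [RHS]pE zE; ring.
by move/(mulfI p0) => qt; rewrite mulrC qt.
Qed.

(** The pair [(q', p')] is [(q, p)] with the common primes removed. By induction on the
    factorization of [p], a prime [r] of [p] either divides [q] and cancels, or divides [y] in every
    relation and is moved into [p']. *)
Lemma syzygies_principal (R : idomainType) (p q : R) : factorial_ring R -> p != 0 ->
  exists p' q', [/\ p' != 0, p * q' = q * p' &
    forall x y, p * x = q * y -> exists z, x = q' * z /\ y = p' * z].
Proof.
move=> ufd /ufd fp; elim: fp q => [u uu|r {}p [r0 ur pr] _ IH] q.
  exists 1, (u^-1 * q); split; rewrite ?oner_neq0 ?mulr1 ?mulVKr //.
  by move=> x y /(canRL (mulKr uu)) ->; exists y; rewrite mul1r mulrA.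
have [[q1 ->]|rq] := classic (divides r q).
  have [p' [q' [p0 e H]]] := IH q1.
  exists p', q'; split=> // [|x y]; first by rewrite -!mulrA e.
  by rewrite -!mulrA => /(mulfI r0); apply: H.
have [p' [q' [p0 e H]]] := IH q.
exists (r * p'), q'; split=> [||x y].
- by rewrite mulf_neq0.
- by rewrite -mulrA e mulrCA.
rewrite -mulrA => exy; case: (pr q y); [by exists (p * x) | by [] |].
case=> y1 yE; move: exy; rewrite yE [q * _]mulrCA => /(mulfI r0) /H[z [-> ->]].
by exists z; rewrite mulrA.
Qed.

(** * Gauss's lemma and prime factorization in one variable *)

Section Polynomials.
Variable R : idomainType.
Implicit Types (p c : R) (f g h k : {poly R}).

Lemma prime_polyC p : prime_elt p -> prime_elt p%:P.
Proof.
move=> [p0 up pp]; split; first by rewrite polyC_eq0.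
  by rewrite poly_unitE coefC eqxx (negPf up) andbF.
elim/poly_ind => [|f a IHf] g; first by move=> _; left; exists 0; rewrite mulr0.
elim/poly_ind: g => [|g b IHg] fg; first by right; exists 0; rewrite mulr0.
(* The quotient has zero constant coefficient, so it is itself a multiple of ['X]. *)
have divX h : divides p%:P (h * 'X) -> divides p%:P h.
  case=> z zE; have: z`_0 = 0.
    apply: (mulfI p0); rewrite mulr0 -[LHS]coefCM -zE coefMX //.
  move=> z0; exists (\poly_(i < (size z).-1) z`_i.+1).
  apply/polyP => i; have := congr1 (fun f => f`_i.+1) zE.
  rewrite coefMX coefCM /= => ->; rewrite coefCM coef_poly; congr (_ * _).
  by case: ltnP => //; rewrite -ltnS => le; rewrite nth_default // (leq_trans (leqSpred _)).
have divC c : divides p c -> divides p%:P c%:P.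
  by case=> z ->; exists z%:P; rewrite polyCM.
have: divides p (a * b).
  case: fg => z zE; exists z`_0.
  have := congr1 (fun f => f`_0) zE; rewrite coefCM => <-.
  by rewrite coef0M !coefD !coefMX !coefC /= !add0r.
case/pp => [/divC pa | /divC pb].
  have /divX/IHf : divides p%:P (f * (g * 'X + b%:P) * 'X).
    rewrite mulrAC -[f * 'X](addrK a%:P) mulrBl.
    by apply: dividesB => //; apply: divides_mulr.
  by case=> [pf|]; [left; apply: dividesD => //; apply: divides_mulr | right].
have /divX/IHg : divides p%:P ((f * 'X + a%:P) * g * 'X).
  rewrite -mulrA -[g * 'X](addrK b%:P) mulrBr.
  by apply: dividesB => //; apply: divides_mull.
by case=> [|pg]; [left | right; apply: dividesD => //; apply: divides_mulr].
Qed.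

Definition primitive f := forall p, prime_elt p -> ~ divides p%:P f.

(** Gauss's lemma: each prime of [c] stays prime in [{poly R}] and cannot divide the primitive [f],
    so it divides [h] and can be cancelled. *)
Lemma Gauss_cancel c f g h : factors c -> primitive f ->
  c%:P * g = f * h -> exists k, h = c%:P * k.
Proof.
move=> fc; elim: fc g h => [u uu|p x pp fx IH] g h Pf e.
  by exists (u^-1%:P * h); rewrite mulrA -polyCM divrr // mul1r.
have [_ _ ppC] := prime_polyC pp.
case: (ppC f h); first by exists (x%:P * g); rewrite -e polyCM mulrA.
  by move/Pf => /(_ pp).
case=> h1 hE; move: e; rewrite hE polyCM -mulrA [f * _]mulrCA.
have p0 : p%:P != 0 by case: pp => p0 _ _; rewrite polyC_eq0.
by move/(mulfI p0) => /IH[//|k ->]; exists k; rewrite mulrA.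
Qed.

(* Induction on a factorization of [c] rather than on [f] makes the removal of
   common factors terminate. *)
Lemma common_primes c f : factors c -> c != 0 ->
  exists d c' f', [/\ c = d * c', f = d%:P * f' &
    forall p, prime_elt p -> divides p c' -> ~ divides p%:P f'].
Proof.
move=> fc; elim: fc f => [u uu|p x pp fx IH] f c0.
  exists 1, u, f; rewrite !mul1r; split=> // p [_ up _] [z uE].
  by move: uu; rewrite uE unitrM (negPf up).
have [p0 _ _] := pp.
have x0 : x != 0 by apply: contraNneq c0 => ->; rewrite mulr0.
have [[f1 ->]|pf] := classic (divides p%:P f).
  have [d [c' [f' [-> -> H]]]] := IH f1 x0.
  by exists (p * d), c', f'; split; rewrite ?polyCM ?mulrA.
have [d [c' [f' [-> fE H]]]] := IH f x0.
exists d, (p * c'), f'; split=> // [|q pq qpc qf]; first by rewrite mulrCA.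
have [_ _ /(_ _ _ qpc)[qp|]] := pq; last by move/H => /(_ pq).
have [z zE] := prime_divides_sym pp pq qp.
apply: pf; rewrite fE; apply: divides_mull; apply: divides_trans qf.
by exists z%:P; rewrite -polyCM zE.
Qed.

Hypothesis ufd : factorial_ring R.

Lemma primitive_part f : f != 0 ->
  exists c g, [/\ c != 0, f = c%:P * g & primitive g].
Proof.
move=> f0; have l0 : lead_coef f != 0 by rewrite lead_coef_eq0.
(* Applied to the leading coefficient of [f], this makes [c'] the leading coefficient of [g]. A
   prime dividing [g] would divide [c'] as well, which [H] excludes. *)
have [d [c' [g [lE fE H]]]] := common_primes f (ufd l0) l0.
have d0 : d != 0 by apply: contraNneq f0; rewrite fE => ->; rewrite mul0r.
exists d, g; split=> // p pp pg; apply: (H p pp) => //.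
have: d * c' = d * lead_coef g by rewrite -lE fE lead_coefM lead_coefC.
move/(mulfI d0) => ->; case: pg => z ->.
by exists (lead_coef z); rewrite lead_coefM lead_coefC.
Qed.

Lemma factors_polyC c : factors c -> factors c%:P.
Proof.
elim=> [u uu|p x pp _ fx]; last first.
  by rewrite polyCM; apply: factors_prime fx; apply: prime_polyC.
have u0 : u != 0 by apply: contraTneq uu => ->; rewrite unitr0.
by apply: factors_unit; rewrite poly_unitE coefC eqxx uu size_polyC u0.
Qed.

(** The last hypothesis is irreducibility over the fraction field, with denominators cleared into
    [c]. Hence the pseudo-gcd of [f] and [g] is either constant, and Bezout shows that [f] divides a
    scalar multiple of [h], or of the same degree as [f], and then [f] divides a scalar multiple of
    [g]. [Gauss_cancel] removes the scalar. *)
Lemma irreducible_prime f : primitive f -> (1 < size f)%N ->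
  (forall c g h, c != 0 -> c *: f = g * h -> (1 < size g < size f)%N -> False) ->
  prime_elt f.
Proof.
move=> Pf sf irr; have f0 : f != 0 by rewrite -size_poly_gt0 ltnW.
split=> //; first by rewrite poly_unitE (gtn_eqF sf).
move=> g h [w ghE].
have [[c1 q1] /= c10 e1] := Pdiv.Idomain.dvdpP _ _ (dvdp_gcdl f g).
have [[c2 q2] /= c20 e2] := Pdiv.Idomain.dvdpP _ _ (dvdp_gcdr f g).
set d := gcdp f g in e1 e2.
have d0 : d != 0 by rewrite gcdp_eq0 (negPf f0).
have sd : (size d <= size f)%N by rewrite leq_gcdpl.
have cancel c x y : c != 0 -> c%:P * x = f * y -> divides f x.
  move=> c0 e; have [t yE] := Gauss_cancel (ufd c0) Pf e.
  exists t; apply: (@mulfI _ c%:P); first by rewrite polyC_eq0.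
  by rewrite e yE mulrCA.
have [sd1|sd1] := eqVneq (size d) 1.
  have [[u v] /= /eqpP[[k1 k2] /= /andP[k10 k20] ek]] := Bezoutp f g.
  move: sd1 => /eqP/size_poly1P[e e0 dE].
  right; apply: (cancel (k2 * e) _ (k1%:P * (u * h + v * w))).
    by rewrite mulf_neq0.
  rewrite -/d dE -!mul_polyC -polyCM in ek; rewrite -ek.
  have -> : k1%:P * (u * f + v * g) * h = k1%:P * (u * f * h + v * (g * h)) by ring.
  by rewrite ghE; ring.
have [dlt|] := ltnP (size d) (size f).
  case: (irr c1 d q1) => //; first by rewrite mulrC.
  by rewrite dlt andbT ltn_neqAle eq_sym sd1 size_poly_gt0.
move=> fd; have {fd} sdE : size d = size f by apply/eqP; rewrite eqn_leq sd.
have q10 : q1 != 0.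
  apply: contraNneq f0 => q0; have := e1; rewrite q0 mul0r => /eqP.
  by rewrite -mul_polyC mulf_eq0 polyC_eq0 (negPf c10).
have: size q1 == 1.
  have := congr1 (fun x : {poly R} => size x) e1.
  rewrite size_scale // size_mul // -sdE -subn1 => sE.
  by have := size_poly_gt0 q1; have := size_poly_gt0 d; rewrite q10 d0; lia.
case/size_poly1P=> e e0 q1E; left; apply: (cancel (c2 * e) _ (c1%:P * q2)).
  by rewrite mulf_neq0.
rewrite -!mul_polyC q1E in e1 e2.
by rewrite polyCM [c2%:P * _]mulrC -mulrA e2 [LHS]mulrCA -e1; ring.
Qed.

(** The content factors in [R]. A nonconstant primitive polynomial is prime unless a scalar multiple
    of it has a factor of intermediate degree; that splitting can be realized over [R], and
    induction on the size applies to both factors. *)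
Lemma factorial_poly : factorial_ring {poly R}.
Proof.
have prim n f : (size f <= n)%N -> primitive f -> f != 0 -> factors f.
  elim: n f => [|n IH] f sf Pf f0.
    by move: sf; rewrite leqn0 size_poly_eq0 (negPf f0).
  have [/size1_polyC fE|sf1] := leqP (size f) 1.
    by rewrite fE; apply/factors_polyC/ufd; rewrite -polyC_eq0 -fE.
  have [[c [g [h [c0 e /andP[sg1 sg]]]]]|irr] := classic (exists c g h,
      [/\ c != 0, c *: f = g * h & (1 < size g < size f)%N]); last first.
    rewrite -[f]mulr1; apply: factors_prime; last exact/factors_unit/unitr1.
    apply: irreducible_prime => // c g h c0 e sz.
    by apply: irr; exists c, g, h.
  have g0 : g != 0 by rewrite -size_poly_gt0 ltnW.
  (* Passing to the primitive part of [g] allows the scalar [c] to be cancelled from the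
     cofactor. *)
  have [d [g' [d0 gE Pg]]] := primitive_part g0.
  rewrite gE -mul_polyC -mulrA [RHS]mulrCA in e.
  have [k kE] := Gauss_cancel (ufd c0) Pg e.
  have fE : f = g' * k.
    apply: (@mulfI _ c%:P); first by rewrite polyC_eq0.
    by rewrite e kE mulrCA.
  have sgE : size g' = size g.
    by rewrite gE mul_polyC size_scale.
  have g'0 : g' != 0 by rewrite -size_poly_gt0 sgE ltnW.
  have k0 : k != 0 by apply: contraNneq f0 => k0; rewrite fE k0 mulr0.
  have sfE : size f = (size g + size k).-1 by rewrite fE size_mul // sgE.
  rewrite fE; apply: factorsM; apply: IH => //.
  - by rewrite sgE -ltnS (leq_trans sg).
  - by rewrite sfE in sf *; lia.
  - by move=> p pp pk; apply: (Pf p pp); rewrite fE; apply: divides_mull.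
move=> f f0; have [c [g [c0 fE Pg]]] := primitive_part f0.
rewrite fE; apply: factorsM; first exact/factors_polyC/ufd.
apply: (prim (size g)) => //.
by apply: contraNneq f0 => g0; rewrite fE g0 mulr0.
Qed.
End Polynomials.

Lemma factorial_iso (R S : idomainType) (f : {rmorphism R -> S}) :
  bijective f -> factorial_ring S -> factorial_ring R.
Proof.
case=> g fK gK ufd x x0.
have g1 : g 1 = 1 by apply: (can_inj fK); rewrite gK rmorph1.
have gM a b : g (a * b) = g a * g b by apply: (can_inj fK); rewrite rmorphM !gK.
have gU u : (g u \is a GRing.unit) = (u \is a GRing.unit).
  apply/idP/idP => [/(rmorph_unit f)|/unitrP[v [vu uv]]]; first by rewrite gK.
  by apply/unitrP; exists (g v); rewrite -!gM vu uv.
have gdiv a b : divides a b <-> divides (g a) (g b).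
  split=> -[z]; first by move=> ->; exists (g z).
  by move=> e; exists (f z); rewrite -[b]gK e rmorphM gK.
have gF y : factors y -> factors (g y).
  elim=> [u uu|p {}y [p0 up pp] fy IH]; first by apply: factors_unit; rewrite gU.
  rewrite gM; apply: factors_prime => //; split; last 1 first.
  - move=> a b; rewrite -[a]fK -[b]fK -gM -!gdiv; exact: pp.
  - by apply: contraNneq p0 => gp0; rewrite -[p]gK gp0 rmorph0.
  - by rewrite gU.
rewrite -[x]fK; apply/gF/ufd; apply: contraNneq x0 => fx0.
by rewrite -[x]fK fx0 -(rmorph0 f) fK.
Qed.

End UniqueFactorization.

(** * Polynomials in several variables *)

Section Mpoly.
Variable F : fieldType.

(** This induction suits maps whose behaviour is known on constants, on sums and under
    multiplication by one variable. *)
Lemma mpoly_ringind m (P : {mpoly F[m]} -> Prop) :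
  (forall c, P c%:MP) -> (forall p q, P p -> P q -> P (p + q)) ->
  (forall i p, P p -> P ('X_i * p)) -> forall p, P p.
Proof.
move=> PC PD PX; have PM p i n : P p -> P ('X_i ^+ n * p).
  by elim: n => [|n IH] Pp; rewrite ?expr0 ?mul1r // exprS -mulrA; apply/PX/IH.
elim/mpolyind => [|c k p _ _ Pp]; first by rewrite -mpolyC0.
apply: PD => //; rewrite -mul_mpolyC mpolyXE_id mulrC -big_enum.
elim: (enum _) => [|i s IH]; first by rewrite big_nil mul1r.
by rewrite big_cons -mulrA; apply: PM.
Qed.

(** The inverse widens the coefficients and evaluates at the last variable. Only the algebraic
    properties of [back] and [mu] are retained; they suffice to check both compositions on
    generators. *)
Lemma muni_bij m : bijective (@muni m F).
Proof.
have [back [backD backM backC backX]] :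
    exists back : {poly {mpoly F[m]}} -> {mpoly F[m.+1]},
    [/\ {morph back : p q / p + q}, {morph back : p q / p * q},
        forall c, back c%:P = mwiden c & back 'X = 'X_ord_max].
  exists (fun q => (map_poly (@mwiden m F) q).['X_ord_max]).
  split=> [p q|p q|c|].
  - by rewrite rmorphD hornerD.
  - by rewrite rmorphM hornerM.
  - by rewrite map_polyC hornerC.
  - by rewrite map_polyX hornerX.
have muniX i : muni (R := F) 'X_(i : 'I_m.+1) =
    'X_[[multinom (U_(i)%MM (widen_ord (leqnSn m) j)) | j < m]] *: 'X^(U_(i)%MM ord_max).
  by rewrite muniE msuppX big_seq1 mcoeffX eqxx scale1r.
have muni_max : muni (R := F) 'X_(ord_max : 'I_m.+1) = 'X.
  rewrite muniX mnmE eqxx expr1.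
  have -> : [multinom (U_(ord_max)%MM (widen_ord (leqnSn m) j)) | j < m] = 0%MM.
    by apply/mnmP => j; rewrite !mnmE -val_eqE /= gtn_eqF.
  by rewrite mpolyX0 scale1r.
have muni_widen j : muni (R := F) 'X_((widen_ord (leqnSn m) j) : 'I_m.+1) = ('X_j)%:P.
  rewrite muniX mnmE -val_eqE /= ltn_eqF // expr0 -alg_polyC.
  congr ('X_[_] *: _); apply/mnmP => k; rewrite !mnmE.
  by congr (nat_of_bool _); apply/eqP/eqP => [/(congr1 val) /= ? |->//]; apply/val_inj.
have [mu [muE muD muM muC muX]] : exists mu : {mpoly F[m.+1]} -> {poly {mpoly F[m]}},
    [/\ mu =1 @muni m F, {morph mu : p q / p + q}, {morph mu : p q / p * q},
        forall c, mu c%:MP = (c%:MP)%:P &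
        mu 'X_ord_max = 'X /\ forall j, mu 'X_(widen_ord (leqnSn m) j) = ('X_j)%:P].
  by exists (@muni m F); split=> // [p q|p q|c]; rewrite ?muniD ?muniM ?muniC.
apply: (eq_bij _ muE); exists back => p.
  elim/mpoly_ringind: p => [c|p q Ep Eq|i p Ep].
  - by rewrite muC backC mwidenC.
  - by rewrite muD backD Ep Eq.
  rewrite muM backM Ep; congr (_ * _).
  have [->|ni] := eqVneq i ord_max; first by rewrite muX.1.
  have lt : (i < m)%N.
    by have := ltn_ord i; rewrite ltnS leq_eqVlt -(inj_eq val_inj) /= in ni *; rewrite (negPf ni).
  have -> : i = widen_ord (leqnSn m) (Ordinal lt) by apply: val_inj.
  by rewrite muX.2 backC mwidenX mnmwiden1.
have mu_mw (c : {mpoly F[m]}) : mu (mwiden c) = c%:P.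
  elim/mpoly_ringind: c => [c|c d Ec Ed|i c Ec].
  - by rewrite mwidenC muC.
  - by rewrite mwidenD muD Ec Ed polyCD.
  by rewrite mwidenM muM Ec mwidenX mnmwiden1 muX.2 polyCM.
elim/poly_ind: p => [|p c Ep].
  by rewrite -[X in back X]polyC0 backC mwiden0 -mpolyC0 muC mpolyC0 polyC0.
by rewrite backD backM backC backX muD muM Ep muX.1 mu_mw.
Qed.

Lemma factorial_mpoly m : factorial_ring {mpoly F[m]}.
Proof.
elim: m => [|m IH].
  move=> p; have -> : p = (p@_0)%:MP.
    apply/mpolyP => k; rewrite mcoeffC; have -> : k = 0%MM by apply/mnmP; case.
    by rewrite eqxx mulr1.
  rewrite mpolyC_eq0 => c0; apply: factors_unit; apply/unitrP.
  by exists ((p@_0)^-1)%:MP; rewrite -!mpolyCM divrr ?mulVr ?unitfE.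
exact: (factorial_iso (muni_bij m) (factorial_poly IH)).
Qed.

End Mpoly.

(** * Anticommuting semilinear operators in rank two *)

Section RankTwo.
Variable R : idomainType.
Implicit Types (f g h u : 'cV[R]_2).

Lemma cV2_eq f g : f 0 0 = g 0 0 -> f 1 0 = g 1 0 -> f = g.
Proof.
move=> e0 e1; apply/matrixP => i j; rewrite ord1.
by case: i => -[|[|]] // lt; [rewrite (_ : Ordinal lt = 0) | rewrite (_ : Ordinal lt = 1)];
  rewrite // -?e0 -?e1 //; apply: val_inj.
Qed.

Definition cV2 (x y : R) : 'cV[R]_2 := \col_i (if i == 0 then x else y).

Lemma cV2E x y : (cV2 x y 0 0 = x) * (cV2 x y 1 0 = y).
Proof. by rewrite !mxE. Qed.

Lemma scale_cV2_eq0 (c : R) f : (c *: f == 0) = (c == 0) || (f == 0).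
Proof.
apply/eqP/orP => [e|[]/eqP ->]; rewrite ?scale0r ?scaler0 //.
have [c0|c0] := eqVneq c 0; [by left | right; apply/eqP].
have := congr1 (fun f => (f 0 0, f 1 0)) e; rewrite !mxE => -[/eqP + /eqP].
rewrite !mulf_eq0 (negPf c0) /= => /eqP e0 /eqP e1.
by apply: cV2_eq; rewrite mxE.
Qed.

Lemma cramer2 f g h : (g 0 0 * f 1 0 - g 1 0 * f 0 0) *: h =
  (h 0 0 * f 1 0 - h 1 0 * f 0 0) *: g + (g 0 0 * h 1 0 - g 1 0 * h 0 0) *: f.
Proof. by apply: cV2_eq; rewrite !mxE; ring. Qed.

(** Two independent elements of [N] would, by Cramer's rule and saturation, force [N] to be
    everything. So [N] consists of relations with the coordinates of [g], which are multiples of a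
    single [u]; and [u] lies in [N] because its nonzero multiple [g] does. *)
Lemma saturated_cyclic (N : 'cV[R]_2 -> Prop) : factorial_ring R ->
  (forall f g, N f -> N g -> N (f + g)) -> (forall c f, N f -> N (c *: f)) ->
  (forall c f, c != 0 -> N (c *: f) -> N f) ->
  (exists2 g, g != 0 & N g) -> (exists h, ~ N h) ->
  exists u, u != 0 /\ forall f, N f <-> exists z, f = z *: u.
Proof.
move=> ufd ND NZ Nsat [g g0 Ng] [h Nh].
have dep f : N f -> g 0 0 * f 1 0 = g 1 0 * f 0 0.
  move=> Nf; apply/eqP; rewrite -subr_eq0; apply: contra_notT Nh => D0.
  by apply: (Nsat _ _ D0); rewrite cramer2; apply: ND; apply: NZ.
have [u Hu] : exists u, forall f, N f -> exists z, f = z *: u.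
  (* [syzygies_principal] needs a nonzero first argument, so the roles of the coordinates depend on
     which entry of [g] is nonzero. *)
  have [g00|g00] := eqVneq (g 0 0) 0.
    have g10 : g 1 0 != 0.
      by apply: contraNneq g0 => g10; apply/eqP/cV2_eq; rewrite mxE.
    have [p [q [_ _ H]]] := syzygies_principal (g 0 0) ufd g10.
    exists (cV2 q p) => f /dep/esym/H[z [f0 f1]]; exists z.
    by apply: cV2_eq; rewrite mxE cV2E mulrC.
  have [p [q [_ _ H]]] := syzygies_principal (g 1 0) ufd g00.
  exists (cV2 p q) => f /dep/H[z [f1 f0]]; exists z.
  by apply: cV2_eq; rewrite mxE cV2E mulrC.
have [z gE] := Hu g Ng.
move: g0; rewrite gE scale_cV2_eq0 negb_or => /andP[z0 u0].
exists u; split=> // f; split=> [/Hu //|[t ->]].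
by apply: NZ; apply: (Nsat z) => //; rewrite -gE.
Qed.

(* Each [t j] acts on the rank one kernel of [t i] by a square-zero operator,
   hence by zero. *)
Lemma common_kernel (I : Type) (i0 : I) (tau : I -> R -> R)
    (t : I -> 'cV[R]_2 -> 'cV[R]_2) : factorial_ring R ->
  (forall i x, tau i x = 0 -> x = 0) ->
  (forall i f g, t i (f + g) = t i f + t i g) ->
  (forall i c f, t i (c *: f) = tau i c *: t i f) ->
  (forall i f, t i (t i f) = 0) ->
  (forall i j f, t i (t j f) = - t j (t i f)) ->
  (forall i, exists f, t i f <> 0) ->
  exists u, u != 0 /\ forall i f, t i f = 0 <-> exists z, f = z *: u.
Proof.
move=> ufd tau0 tD tZ tt tC tn.
have t0 i : t i 0 = 0 by apply: (addrI (t i 0)); rewrite -tD !addr0.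
have ker i : exists u, u != 0 /\ forall f, t i f = 0 <-> exists z, f = z *: u.
  apply: saturated_cyclic => //.
  - by move=> f g f0 g0; rewrite tD f0 g0 addr0.
  - by move=> c f f0; rewrite tZ f0 scaler0.
  - move=> c f c0 /eqP; rewrite tZ scale_cV2_eq0 => /orP[/eqP/tau0 c0'|/eqP //].
    by rewrite c0' eqxx in c0.
  (* As [t i] squares to zero, its nonzero image supplies a nonzero kernel element. *)
  - by have [f /eqP fn] := tn i; exists (t i f).
have sub i j f : t i f = 0 -> t j f = 0.
  have [u [u0 Hu]] := ker i.
  suff tju : t j u = 0 by move/Hu => [z ->]; rewrite tZ tju scaler0.
  have tiu : t i u = 0 by apply/Hu; exists 1; rewrite scale1r.
  have /Hu[p pE] : t i (t j u) = 0.
    by rewrite tC tiu t0 oppr0.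
  have /eqP := tt j u; rewrite pE tZ pE scalerA scale_cV2_eq0 (negPf u0) orbF.
  rewrite mulf_eq0 => /orP[/eqP/tau0|/eqP] ->; exact: scale0r.
have [u [u0 Hu]] := ker i0; exists u; split=> // i f; rewrite -Hu.
by split; apply: sub.
Qed.

End RankTwo.

(** * Shift automorphisms and divisors of monomials *)

Section Shift.
Variables (F : fieldType) (m : nat).
Implicit Types (p q : {mpoly F[m]}) (c : 'I_m -> F).

Lemma shiftD c p q : shift c (p + q) = shift c p + shift c q.
Proof. exact: rmorphD. Qed.

Lemma shiftM c p q : shift c (p * q) = shift c p * shift c q.
Proof. exact: rmorphM. Qed.

Lemma shiftC c (x : F) : shift c x%:MP = x%:MP.
Proof. by rewrite /shift comp_mpolyC. Qed.

(** [Delta] lowers every variable by one and [sigmaV i] restores ['X_i], so only the other variables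
    move. *)
Lemma Delta_E i : @Delta_ F m i =1 shift (fun j => - (j != i)%:R).
Proof.
move=> p; rewrite /Delta_ /Delta /= /sigma /sigmaV big_shift shift_shift.
apply: Defs.eq_shift => j; rewrite (bigD1 j) //= eqxx big1 => [|k /negPf]; last first.
  by rewrite eq_sym => ->; rewrite oppr0.
by case: eqP => _ /=; ring.
Qed.

Lemma Delta_VE i : @Delta_V F m i =1 shift (fun j => (j != i)%:R).
Proof.
move=> p; rewrite /Delta_V /DeltaV /= /sigma /sigmaV big_shift shift_shift.
apply: Defs.eq_shift => j; rewrite (bigD1 j) //= eqxx big1 => [|k /negPf]; last first.
  by rewrite eq_sym => ->.
by case: eqP => _ /=; ring.
Qed.

Lemma mlead0_const p : mlead p = 0%MM -> exists x, p = x%:MP.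
Proof.
have [->|p0 lp] := eqVneq p 0; first by exists 0; rewrite mpolyC0.
have /eqP/msize_poly1P[c _ pE] : msize p = 1 by rewrite -mlead_deg // lp mdeg0.
by exists c.
Qed.

Lemma mpolyX_neq0 i : 'X_i != 0 :> {mpoly F[m]}.
Proof. by rewrite -mleadc_eq0 mleadXm mcoeffX eqxx oner_eq0. Qed.

(** The degrees of the leading monomials add up to one, so one factor has degree zero. *)
Lemma mul_eqX i p q : p * q = 'X_i -> (exists x, p = x%:MP) \/ exists x, q = x%:MP.
Proof.
move=> e; have X0 := mpolyX_neq0 i.
have /andP[p0 q0] : (p != 0) && (q != 0) by rewrite -negb_or -mulf_eq0 e.
have := congr1 (fun x => mdeg (mlead x)) e; rewrite mleadM // mleadXm mdegD mdeg1 => ed.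
have [|] := eqVneq (mdeg (mlead p)) 0%N.
  by move/eqP; rewrite mdeg_eq0 => /eqP/mlead0_const; left.
move=> n0; have /eqP : mdeg (mlead q) = 0%N.
  by move: ed n0; case: (mdeg (mlead p)) => [|[|d]] // [].
by rewrite mdeg_eq0 => /eqP/mlead0_const; right.
Qed.

(** The leading monomial of [D] divides those of both squares, which share no variable. *)
Lemma common_divisor_const i j D p q : i != j ->
  D * p = 'X_i * 'X_i -> D * q = 'X_j * 'X_j -> exists2 x, x != 0 & D = x%:MP.
Proof.
move=> ij ep eq.
have X0 k : 'X_k * 'X_k != 0 :> {mpoly F[m]} by rewrite mulf_neq0 ?mpolyX_neq0.
have := X0 i; rewrite -ep mulf_eq0 negb_or => /andP[D0 p0].
have := X0 j; rewrite -eq mulf_eq0 negb_or => /andP[_ q0].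
have lead0 : mlead D = 0%MM.
  have := congr1 (fun x => mlead x) ep; have := congr1 (fun x => mlead x) eq.
  rewrite !mleadM ?mpolyX_neq0 // !mleadXm => /mnmP eq' /mnmP ep'.
  apply/mnmP => k; move: (eq' k) (ep' k); rewrite !mnmE.
  have [ik|_] := eqVneq i k; last by move=> _ /eqP; rewrite addn_eq0 => /andP[/eqP].
  have [jk|_] := eqVneq j k; first by rewrite ik jk eqxx in ij.
  by move=> /eqP; rewrite addn_eq0 => /andP[/eqP].
have [c DE] := mlead0_const lead0; exists c => //.
by apply: contraNneq D0; rewrite DE => ->; rewrite mpolyC0.
Qed.

End Shift.

(** * Normal form of the odd operators in rank two *)

Section RankTwoOperators.
Variables (F : fieldType) (m : nat).
Local Notation A := {mpoly F[m]}.
Variables (al be : 'I_m -> 'cV[A]_2 -> 'cV[A]_2).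
Hypothesis m_gt1 : (1 < m)%N.
Hypothesis char2 : 2%:R != 0 :> F.
Hypothesis alD : forall i, {morph al i : f g / f + g}.
Hypothesis beD : forall i, {morph be i : f g / f + g}.
Hypothesis alZ : forall i (p : A) f, al i (p *: f) = Delta_V i p *: al i f.
Hypothesis beZ : forall i (p : A) f, be i (p *: f) = Delta_ i p *: be i f.
Hypothesis alC : forall i j f, al i (al j f) = - al j (al i f).
Hypothesis beC : forall i j f, be i (be j f) = - be j (be i f).
Hypothesis albe : forall i f, al i (be i f) + be i (al i f) = 'X_i *: f.

Lemma anticommuting_sqr (t : 'I_m -> 'cV[A]_2 -> 'cV[A]_2) :
  (forall i j f, t i (t j f) = - t j (t i f)) -> forall i f, t i (t i f) = 0.
Proof.
move=> tC i f; have /eqP : (2%:R : F)%:MP *: t i (t i f) = 0.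
  rewrite mpolyCMn mpolyC1 mulr2n scalerDl scale1r {1}tC addNr //.
by rewrite scale_cV2_eq0 mpolyC_eq0 (negPf char2) => /eqP.
Qed.

Lemma Delta_0 i : @Delta_ F m i 0 = 0.
Proof. by rewrite Delta_E -mpolyC0 shiftC. Qed.

Lemma Delta_V0 i : @Delta_V F m i 0 = 0.
Proof. by rewrite Delta_VE -mpolyC0 shiftC. Qed.

Lemma rank_two_basis : exists u w : 'cV[A]_2,
  [/\ (forall f, exists x y, f = x *: u + y *: w),
      (forall x y, x *: u + y *: w = 0 -> x = 0 /\ y = 0),
      (forall i, al i u = 0), (forall i, be i w = 0) &
      forall i, exists p q : A, [/\ al i w = p *: u, be i u = q *: w,
        p * Delta_V i q = 'X_i & Delta_ i p * q = 'X_i]].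
Proof.
pose i0 := Ordinal (ltnW m_gt1); pose i1 := Ordinal m_gt1.
have ufd : factorial_ring A := @factorial_mpoly F m.
have alal := anticommuting_sqr alC; have bebe := anticommuting_sqr beC.
pose e0 : 'cV[A]_2 := cV2 1 0; pose e1 : 'cV[A]_2 := cV2 0 1.
have e00 : e0 != 0.
  by apply/eqP => /matrixP/(_ 0 0); rewrite cV2E mxE; apply/eqP/oner_neq0.
have al0 i : al i 0 = 0 by apply: (addrI (al i 0)); rewrite -alD !addr0.
have be0 i : be i 0 = 0 by apply: (addrI (be i 0)); rewrite -beD !addr0.
have X0 i := @mpolyX_neq0 F m i.
have [u [u0 Hu]] : exists u : 'cV[A]_2, u != 0 /\
    forall i f, al i f = 0 <-> exists z, f = z *: u.
  apply: (common_kernel i0 (tau := fun i => Delta_V i)) => //.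
    by move=> i x x0; rewrite -[x](Delta_VK i) x0 Delta_0.
  move=> i; apply: NNPP => ni.
  have ni' f : al i f = 0 by apply: NNPP => nf; apply: ni; exists f.
  have := albe i e0; rewrite !ni' be0 addr0 => /esym/eqP.
  by rewrite scale_cV2_eq0 (negPf (X0 i)) (negPf e00).
have [w [w0 Hw]] : exists w : 'cV[A]_2, w != 0 /\
    forall i f, be i f = 0 <-> exists z, f = z *: w.
  apply: (common_kernel i0 (tau := fun i => Delta_ i)) => //.
    by move=> i x x0; rewrite -[x](Delta_K i) x0 Delta_V0.
  move=> i; apply: NNPP => ni.
  have ni' f : be i f = 0 by apply: NNPP => nf; apply: ni; exists f.
  have := albe i e0; rewrite !ni' al0 addr0 => /esym/eqP.
  by rewrite scale_cV2_eq0 (negPf (X0 i)) (negPf e00).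
have alu i : al i u = 0 by apply/Hu; exists 1; rewrite scale1r.
have bew i : be i w = 0 by apply/Hw; exists 1; rewrite scale1r.
(* A vector killed by both operators is killed by ['X_i], hence zero; this is what separates the
   lines of [u] and [w]. *)
have ker0 i f : al i f = 0 -> be i f = 0 -> f = 0.
  move=> af bf; have := albe i f; rewrite af bf al0 be0 addr0 => /esym/eqP.
  by rewrite scale_cV2_eq0 (negPf (X0 i)) => /eqP.
have alE i f : exists x, al i f = x *: u by apply/(Hu i).
have beE i f : exists y, be i f = y *: w by apply/(Hw i).
have indep x y : x *: u + y *: w = 0 -> x = 0 /\ y = 0.
  move=> e; have xu : x *: u = 0.
    apply: (ker0 i0); first by rewrite alZ alu scaler0.
    have := congr1 (be i0) e; rewrite beD be0 [be i0 (y *: w)]beZ bew scaler0 addr0 //.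
  move: e; rewrite xu add0r => /eqP; rewrite scale_cV2_eq0 (negPf w0) orbF => /eqP ->.
  by move/eqP: xu; rewrite scale_cV2_eq0 (negPf u0) orbF => /eqP.
have Xspan i f : exists x y, 'X_i *: f = x *: u + y *: w.
  by rewrite -albe; have [x ->] := alE i (be i f); have [y ->] := beE i (al i f); exists x, y.
pose D : A := u 0 0 * w 1 0 - u 1 0 * w 0 0.
(* The coordinates of ['X_i *: e0] and ['X_i *: e1] along [u] and [w] form a square matrix. Its
   determinant times [D] is the determinant of ['X_i] times the identity. *)
have Ddiv i : exists p, D * p = 'X_i * 'X_i.
  have [x [y exy]] := Xspan i e0; have [x' [y' exy']] := Xspan i e1.
  exists (x * y' - y * x').
  have ent k := (congr1 (fun f : 'cV[A]_2 => f k 0) exy,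
                 congr1 (fun f : 'cV[A]_2 => f k 0) exy').
  move: (ent 0) (ent 1); rewrite !mxE /= !mulr0 !mulr1 => -[a0 b0] [a1 b1].
  have -> : D * (x * y' - y * x') = (x * u 0 0 + y * w 0 0) * (x' * u 1 0 + y' * w 1 0)
      - (x * u 1 0 + y * w 1 0) * (x' * u 0 0 + y' * w 0 0) by rewrite /D; ring.
  by rewrite -a0 -b0 -a1 -b1 mulr0 subr0.
have [c c0 Dc] : exists2 c, c != 0 & D = c%:MP.
  have [[p ep] [q eq]] := (Ddiv i0, Ddiv i1).
  exact: (common_divisor_const _ ep eq).
exists u, w; split=> // [f|i].
  (* These are Cramer's coordinates divided by the constant determinant. *)
  exists ((c^-1)%:MP * (f 0 0 * w 1 0 - f 1 0 * w 0 0)),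
    ((c^-1)%:MP * (u 0 0 * f 1 0 - u 1 0 * f 0 0)).
  rewrite -!scalerA -scalerDr -cramer2 -/D Dc scalerA -mpolyCM mulVf // mpolyC1.
  by rewrite scale1r.
have [p pE] := alE i w; have [q qE] := beE i u.
exists p, q; split=> //; apply/eqP; rewrite -subr_eq0.
  suff : (p * Delta_V i q - 'X_i) *: u == 0 by rewrite scale_cV2_eq0 (negPf u0) orbF.
  by rewrite scalerBl -albe alu be0 addr0 qE alZ pE scalerA mulrC subrr.
suff : (Delta_ i p * q - 'X_i) *: w == 0 by rewrite scale_cV2_eq0 (negPf w0) orbF.
by rewrite scalerBl -albe bew al0 add0r pE beZ qE scalerA subrr.
Qed.

(** In [p * Delta_V i q = 'X_i] one factor is constant. Shifts fix constants, so the other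
    coefficient is the inverse constant times ['X_i]. The set [S] collects the indices where the
    coefficient of [be i] is taken to be the constant one. *)
Lemma rank_two_normal_form : exists (u w : 'cV[A]_2) (a : 'I_m -> F) (S : {set 'I_m}),
  [/\ (forall f, exists x y, f = x *: u + y *: w),
      (forall x y, x *: u + y *: w = 0 -> x = 0 /\ y = 0),
      (forall i, a i != 0),
      (forall i, al i u = 0 /\ be i w = 0) &
      forall i,
        al i w = (if i \in S then a i *: 'X_i else (a i)%:MP) *: u /\
        be i u = (if i \in S then ((a i)^-1)%:MP else (a i)^-1 *: 'X_i) *: w].
Proof.
have [u [w [span indep alu bew H]]] := rank_two_basis.
have Hi i : exists c : F * bool, c.1 != 0 /\
    al i w = (if c.2 then c.1 *: 'X_i else (c.1)%:MP) *: u /\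
    be i u = (if c.2 then (c.1^-1)%:MP else c.1^-1 *: 'X_i) *: w.
  have [p [q [-> -> epq eqp]]] := H i.
  have X0 := @mpolyX_neq0 F m i.
  have [[c pE]|[d qE]] := mul_eqX epq.
    have c0 : c != 0.
      by apply: contraNneq X0 => c0; rewrite -epq pE c0 mpolyC0 mul0r.
    exists (c, false); rewrite /= pE; split=> //; split=> //; congr (_ *: _).
    rewrite -eqp pE Delta_E shiftC mul_mpolyC scalerA mulVf // scale1r //.
  (* The constant found is [Delta_V i q]; shifting back shows that [q] is the same constant. *)
  have {}qE : q = d%:MP by rewrite -[q](Delta_VK i) qE Delta_E shiftC.
  have d0 : d != 0.
    by apply: contraNneq X0 => d0; rewrite -eqp qE d0 mpolyC0 mulr0.
  exists (d^-1, true); rewrite /= invr_eq0 invrK qE; split=> //; split=> //; congr (_ *: _).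
  by rewrite -epq qE Delta_VE shiftC mulrC mul_mpolyC scalerA mulVf // scale1r.
have [c Hc] : exists c : 'I_m -> F * bool, forall i, (c i).1 != 0 /\
    al i w = (if (c i).2 then (c i).1 *: 'X_i else (c i).1%:MP) *: u /\
    be i u = (if (c i).2 then ((c i).1^-1)%:MP else (c i).1^-1 *: 'X_i) *: w.
  by have [c] := fin_all_exists Hi; exists c.
exists u, w, (fun i => (c i).1), [set i | (c i).2]; split=> //.
- by move=> i; case: (Hc i).
- by move=> i; rewrite inE; case: (Hc i).
Qed.

End RankTwoOperators.

(** * Modules over U(sl(m|1)) free of rank two over U(h) *)

Section Brackets.
Variables (F : fieldType) (m : nat).
Implicit Types i j : 'I_m.
Local Notation sl := (sl F m).

Lemma sl_inj (x y : sl) : sl_val x = sl_val y -> x = y.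
Proof. by move=> e; apply: val_inj. Qed.

Lemma sl_valD (x y : sl) : sl_val (x + y) = sl_val x + sl_val y.
Proof. by []. Qed.

Lemma sl_valZ c (x : sl) : sl_val (c *: x) = c *: sl_val x.
Proof. by []. Qed.

Lemma ev_od i : (ev i == od m) = false.
Proof. by rewrite /ev /od eq_lrshift. Qed.

Lemma od_ev i : (od m == ev i) = false.
Proof. by rewrite /ev /od eq_rlshift. Qed.

Lemma ev_eq i j : (ev i == ev j) = (i == j).
Proof. by rewrite /ev eq_lshift. Qed.

Lemma has_parityP (p : bool) (X : 'M[F]_(m + 1)) :
  (forall i j, p -> X (ev i) (ev j) = 0) -> (p -> X (od m) (od m) = 0) ->
  (forall i, ~~ p -> X (ev i) (od m) = 0) -> (forall i, ~~ p -> X (od m) (ev i) = 0) ->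
  has_parity p X.
Proof.
move=> H1 H2 H3 H4; rewrite /has_parity -[RHS]submxK /part.
by case: p H1 H2 H3 H4 => H1 H2 H3 H4; congr block_mx;
  apply/matrixP => i j; rewrite ?mxE ?ord1 ?(H1 _ _ isT) ?(H2 isT) ?(H3 _ isT) ?(H4 _ isT).
Qed.

Lemma parity_h i : has_parity false (sl_val (h_ F i)).
Proof.
by apply: has_parityP => // j _; rewrite !mxE !(ev_od, od_ev) ?andbF ?addr0.
Qed.

Lemma parity_i1 i : has_parity true (sl_val (e_i1 F i)).
Proof.
by apply: has_parityP => // [j k|] _; rewrite !mxE !(ev_od, od_ev) ?andbF.
Qed.

Lemma parity_1i i : has_parity true (sl_val (e_1i F i)).
Proof.
by apply: has_parityP => // [j k|] _; rewrite !mxE !(ev_od, od_ev) ?andbF.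
Qed.

Definition deltaE := (mul_delta_mx_cond, ev_od, od_ev, ev_eq, mulr0n, mulr1n, eqxx).

Lemma bracket_hh i j : sbracket (h_ F i) (h_ F j) = 0.
Proof.
apply: sl_inj; rewrite /= (mx_sbracketE (parity_h i) (parity_h j)) expr0 scale1r.
rewrite /= !mulmxDl !mulmxDr !deltaE !addr0 !add0r [j == i]eq_sym.
by case: eqVneq => [->|_]; rewrite ?mulr1n ?mulr0n ?add0r subrr.
Qed.

(** The even unit at [ev j] contributes one when [j = i], and the unit at [od] always contributes
    minus one. This weight is the origin of the shift [Delta_V i]. *)
Lemma bracket_h_i1 j i : sbracket (h_ F j) (e_i1 F i) = - (j != i)%:R *: e_i1 F i.
Proof.
apply: sl_inj; rewrite sl_valZ /= (mx_sbracketE (parity_h j) (parity_i1 i)) expr0 scale1r.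
rewrite /= !mulmxDl !mulmxDr !deltaE !addr0 ?add0r.
by case: eqVneq => [->|_]; rewrite ?mulr1n ?mulr0n ?subrr ?oppr0 ?scale0r // add0r scaleN1r.
Qed.

Lemma bracket_h_1i j i : sbracket (h_ F j) (e_1i F i) = (j != i)%:R *: e_1i F i.
Proof.
apply: sl_inj; rewrite sl_valZ /= (mx_sbracketE (parity_h j) (parity_1i i)) expr0 scale1r.
rewrite /= !mulmxDl !mulmxDr !deltaE ?addr0 ?add0r [i == j]eq_sym.
by case: eqVneq => [->|_]; rewrite ?mulr1n ?mulr0n ?subrr ?scale0r // subr0 scale1r.
Qed.

Lemma bracket_i1_i1 i j : sbracket (e_i1 F i) (e_i1 F j) = 0.
Proof.
apply: sl_inj; rewrite /= (mx_sbracketE (parity_i1 i) (parity_i1 j)).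
by rewrite /= !deltaE scaler0 subrr.
Qed.

Lemma bracket_1i_1i i j : sbracket (e_1i F i) (e_1i F j) = 0.
Proof.
apply: sl_inj; rewrite /= (mx_sbracketE (parity_1i i) (parity_1i j)).
by rewrite /= !deltaE scaler0 subrr.
Qed.

Lemma bracket_i1_1i i : sbracket (e_i1 F i) (e_1i F i) = h_ F i.
Proof.
apply: sl_inj; rewrite /= (mx_sbracketE (parity_i1 i) (parity_1i i)).
by rewrite /= !deltaE expr1 scaleN1r opprK.
Qed.

End Brackets.

(** * The polynomial action of U(h) and semilinearity of the odd elements *)

Section UhAction.
Variables (F : fieldType) (m : nat) (V : lmodType F) (rho : sl F m -> V -> V).
Hypothesis rhoP : is_umodule rho.
Local Notation A := {mpoly F[m]}.
Implicit Types (p q : A) (v : V).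

Lemma rhoD x : {morph rho x : v w / v + w}.
Proof. by move=> v w; have := umod_linearr rhoP x 1 v w; rewrite !scale1r. Qed.

Lemma rho0r x : rho x 0 = 0.
Proof. by apply: (addrI (rho x 0)); rewrite -rhoD !addr0. Qed.

Lemma rhoZ x c v : rho x (c *: v) = c *: rho x v.
Proof. by have := umod_linearr rhoP x c v 0; rewrite !addr0 rho0r addr0. Qed.

Lemma rhoDl x y v : rho (x + y) v = rho x v + rho y v.
Proof. by have := umod_linearl rhoP v 1 x y; rewrite !scale1r. Qed.

Lemma rho0l v : rho 0 v = 0.
Proof. by apply: (addrI (rho 0 v)); rewrite -rhoDl !addr0. Qed.

Lemma rhoZl c x v : rho (c *: x) v = c *: rho x v.
Proof. by have := umod_linearl rhoP v c x 0; rewrite !addr0 rho0l addr0. Qed.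

Lemma rho_hC i j v : rho (h_ F i) (rho (h_ F j) v) = rho (h_ F j) (rho (h_ F i) v).
Proof.
have := umod_bracket rhoP v (parity_h F i) (parity_h F j).
by rewrite bracket_hh rho0l expr0 scale1r => /esym/eqP; rewrite subr_eq0 => /eqP.
Qed.

Lemma rho_i1_h i j v : rho (e_i1 F i) (rho (h_ F j) v) =
  rho (h_ F j) (rho (e_i1 F i) v) + (j != i)%:R *: rho (e_i1 F i) v.
Proof.
have := umod_bracket rhoP v (parity_h F j) (parity_i1 F i).
rewrite bracket_h_i1 rhoZl expr0 scale1r scaleNr => e.
by rewrite -[_%:R *: _]opprK e opprB addrC subrK.
Qed.

Lemma rho_1i_h i j v : rho (e_1i F i) (rho (h_ F j) v) =
  rho (h_ F j) (rho (e_1i F i) v) - (j != i)%:R *: rho (e_1i F i) v.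
Proof.
have := umod_bracket rhoP v (parity_h F j) (parity_1i F i).
by rewrite bracket_h_1i rhoZl expr0 scale1r => ->; rewrite opprB addrC subrK.
Qed.

Lemma rho_i1_i1 i j v : rho (e_i1 F i) (rho (e_i1 F j) v) = - rho (e_i1 F j) (rho (e_i1 F i) v).
Proof.
have := umod_bracket rhoP v (parity_i1 F i) (parity_i1 F j).
by rewrite bracket_i1_i1 rho0l expr1 scaleN1r opprK => /esym/eqP; rewrite addr_eq0 => /eqP.
Qed.

Lemma rho_1i_1i i j v : rho (e_1i F i) (rho (e_1i F j) v) = - rho (e_1i F j) (rho (e_1i F i) v).
Proof.
have := umod_bracket rhoP v (parity_1i F i) (parity_1i F j).
by rewrite bracket_1i_1i rho0l expr1 scaleN1r opprK => /esym/eqP; rewrite addr_eq0 => /eqP.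
Qed.

Lemma rho_i1_1i i v : rho (e_i1 F i) (rho (e_1i F i) v) + rho (e_1i F i) (rho (e_i1 F i) v) =
  rho (h_ F i) v.
Proof.
have := umod_bracket rhoP v (parity_i1 F i) (parity_1i F i).
by rewrite bracket_i1_1i expr1 scaleN1r opprK.
Qed.

(** The operators of the [h_] commute, so the extra factor moves to the front. Along a
    duplicate-free list it is met once if [i] occurs and never otherwise. *)
Lemma Uh_monomU i k v : Uh_monom rho (U_(i) + k)%MM v = rho (h_ F i) (Uh_monom rho k v).
Proof.
have fold_U s : uniq s ->
    foldr (fun j w => iter ((U_(i) + k)%MM j) (rho (h_ F j)) w) v s =
    iter (i \in s) (rho (h_ F i)) (foldr (fun j w => iter (k j) (rho (h_ F j)) w) v s).
  elim: s => //= j s IH /andP[js us]; rewrite {}IH // in_cons mnmDE mnm1E.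
  have comm n w : iter n (rho (h_ F j)) (rho (h_ F i) w) =
      rho (h_ F i) (iter n (rho (h_ F j)) w).
    by elim: n => //= n ->; rewrite rho_hC.
  have [->|ij] := eqVneq i j; first by rewrite (negPf js) /= -iterS.
  by case: (i \in s); rewrite /= ?comm.
by rewrite /Uh_monom fold_U ?enum_uniq // mem_enum.
Qed.

(** A common finite set of monomials lets polynomials with different supports be compared
    termwise. *)
Lemma Uh_actwE d p v : (msize p <= d)%N ->
  Uh_act rho p v = \sum_(k : 'X_{1..m < d}) p@_k *: Uh_monom rho k v.
Proof.
pose I : subFinType _ := 'X_{1..m < d}.
move=> le; rewrite /Uh_act (big_mksub I) ?msupp_uniq //=; first last.
  by move=> x /msize_mdeg_lt /leq_trans; apply.
rewrite big_rmcond //= => i; move/memN_msupp_eq0 ->.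
by rewrite scale0r.
Qed.

Lemma Uh_actD p q v : Uh_act rho (p + q) v = Uh_act rho p v + Uh_act rho q v.
Proof.
pose d := maxn (msize (p + q)) (maxn (msize p) (msize q)).
rewrite !(@Uh_actwE d) ?leq_max ?leqnn ?orbT // -big_split.
by apply: eq_bigr => k _; rewrite mcoeffD scalerDl.
Qed.

Lemma Uh_actZ c p v : Uh_act rho (c *: p) v = c *: Uh_act rho p v.
Proof.
pose d := maxn (msize (c *: p)) (msize p).
rewrite !(@Uh_actwE d) ?leq_max ?leqnn ?orbT // scaler_sumr.
by apply: eq_bigr => k _; rewrite mcoeffZ scalerA.
Qed.

Lemma Uh_actXn k v : Uh_act rho 'X_[k] v = Uh_monom rho k v.
Proof. by rewrite /Uh_act msuppX big_seq1 mcoeffX eqxx scale1r. Qed.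

Lemma Uh_act0 v : Uh_act rho 0 v = 0.
Proof. by rewrite /Uh_act msupp0 big_nil. Qed.

Lemma Uh_actC c v : Uh_act rho c%:MP v = c *: v.
Proof.
rewrite -[c%:MP]mulr1 mul_mpolyC Uh_actZ -mpolyX0 Uh_actXn /Uh_monom.
by congr (_ *: _); elim: (enum _) => //= i s ->; rewrite mnm0E.
Qed.

Lemma Uh_actX i p v : Uh_act rho ('X_i * p) v = rho (h_ F i) (Uh_act rho p v).
Proof.
elim/mpolyind: p => [|c k p _ _ IH]; first by rewrite mulr0 Uh_act0 rho0r.
rewrite mulrDr -scalerAr -mpolyXD !Uh_actD !Uh_actZ !Uh_actXn Uh_monomU IH.
by rewrite rhoD rhoZ.
Qed.

Lemma Uh_actM p q v : Uh_act rho (p * q) v = Uh_act rho p (Uh_act rho q v).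
Proof.
elim/mpoly_ringind: p => [c|p p' IH IH'|i p IH].
- by rewrite mul_mpolyC Uh_actZ Uh_actC.
- by rewrite mulrDl !Uh_actD IH IH'.
- by rewrite -mulrA !Uh_actX IH.
Qed.

Lemma Uh_actDr p v w : Uh_act rho p (v + w) = Uh_act rho p v + Uh_act rho p w.
Proof.
elim/mpoly_ringind: p => [c|p p' IH IH'|i p IH].
- by rewrite !Uh_actC scalerDr.
- by rewrite !Uh_actD IH IH' addrACA.
- by rewrite !Uh_actX IH rhoD.
Qed.

(** Moving [e_i1 i] past [h_ j] replaces [h_ j] by [h_ j + 1] exactly when [j != i], which is
    [Delta_V i] on the variables; sums and products follow. *)
Lemma rho_i1_act i p v :
  rho (e_i1 F i) (Uh_act rho p v) = Uh_act rho (Delta_V i p) (rho (e_i1 F i) v).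
Proof.
rewrite Delta_VE; elim/mpoly_ringind: p => [c|p p' IH IH'|j p IH].
- by rewrite shiftC !Uh_actC rhoZ.
- by rewrite shiftD !Uh_actD rhoD IH IH'.
rewrite shiftM shiftX mulrDl Uh_actD mul_mpolyC Uh_actZ !Uh_actX rho_i1_h.
by rewrite IH.
Qed.

Lemma rho_1i_act i p v :
  rho (e_1i F i) (Uh_act rho p v) = Uh_act rho (Delta_ i p) (rho (e_1i F i) v).
Proof.
rewrite Delta_E; elim/mpoly_ringind: p => [c|p p' IH IH'|j p IH].
- by rewrite shiftC !Uh_actC rhoZ.
- by rewrite shiftD !Uh_actD rhoD IH IH'.
rewrite shiftM shiftX mulrDl Uh_actD mul_mpolyC Uh_actZ !Uh_actX rho_1i_h.
by rewrite IH scaleNr.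
Qed.

End UhAction.

Lemma mul_E01 (R : idomainType) (c : R) (g : 'cV[R]_2) :
  (c *: delta_mx 0 1 : 'M_2) *m g = cV2 (c * g 1 0) 0.
Proof.
have e1 : lift ord0 ord0 = 1 :> 'I_2 by apply: val_inj.
by apply: cV2_eq; rewrite -scalemxAl !mxE big_ord_recl big_ord1 e1 !mxE /= ?mul0r;
  rewrite ?(mul1r, add0r, addr0, mulr0).
Qed.

Lemma mul_E10 (R : idomainType) (c : R) (g : 'cV[R]_2) :
  (c *: delta_mx 1 0 : 'M_2) *m g = cV2 0 (c * g 0 0).
Proof.
have e1 : lift ord0 ord0 = 1 :> 'I_2 by apply: val_inj.
by apply: cV2_eq; rewrite -scalemxAl !mxE big_ord_recl big_ord1 e1 !mxE /= ?mul0r;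
  rewrite ?(mul1r, add0r, addr0, mulr0).
Qed.

Lemma umodule_transport (F : fieldType) m (V W : lmodType F)
    (rho : sl F m -> V -> V) (phi : W -> V) (psi : V -> W) :
  linear phi -> cancel phi psi -> cancel psi phi -> is_umodule rho ->
  is_umodule (fun x w => psi (rho x (phi w))).
Proof.
move=> lphi phiK psiK rhoP.
have lpsi : linear psi by move=> c v w; apply: (can_inj phiK); rewrite lphi !psiK.
split=> [w c x y|x c v w|p q x y v px qy].
- by rewrite (umod_linearl rhoP) lpsi.
- by rewrite lphi (umod_linearr rhoP) lpsi.
rewrite (umod_bracket rhoP (phi v) px qy) !psiK.
rewrite addrC -scaleNr lpsi scaleNr addrC //.
Qed.

(** * Classification of the modules of rank two *)

Section Classification.
Variables (F : fieldType) (m : nat) (V : lmodType F) (rho : sl F m -> V -> V).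
Local Notation A := {mpoly F[m]}.

Lemma polyvecZ c (f : polyvec F m) : (c *: f : polyvec F m) = (c%:MP : A) *: (f : 'cV[A]_2).
Proof. by apply: cV2_eq; rewrite !mxE mul_mpolyC. Qed.

Lemma rank_two_classification : (1 < m)%N -> 2%:R != 0 :> F -> in_M 2 rho ->
  exists (a : 'I_m -> F) (S : {set 'I_m})
         (rho' : sl F m -> polyvec F m -> polyvec F m),
    [/\ forall i, a i != 0, is_Mas a S rho' & umod_iso rho rho'].
Proof.
move=> m_gt1 char2 [rhoP [b free_b]].
(* Coordinates in the free basis [b] identify [V] with [C[h]^2], so that the rank two normal form
   applies to the transported operators [al] and [be]. *)
pose phi (f : 'cV[A]_2) : V := Uh_act rho (f 0 0) (b ord0) + Uh_act rho (f 1 0) (b 1).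
have phiD f g : phi (f + g) = phi f + phi g by rewrite /phi !mxE !Uh_actD addrACA.
have phiZ p f : phi (p *: f) = Uh_act rho p (phi f).
  by rewrite /phi !mxE !Uh_actM ?Uh_actDr.
have phi_inj : injective phi.
  move=> f g efg; have [h [_ hU]] := free_b (phi f).
  have eta k : phi f = phi k -> h = [ffun i => k i 0].
    move=> e; apply: hU; rewrite e big_ord_recl big_ord1 !ffunE.
    congr (_ + Uh_act rho (k _ 0) (b _)); exact: val_inj.
  have := eta g efg; rewrite (eta f) // => /ffunP e.
  by apply: cV2_eq; [have := e 0 | have := e 1]; rewrite !ffunE.
have phi_surj v : exists f, v == phi f.
  have [h [-> _]] := free_b v; exists (cV2 (h 0) (h 1)); apply/eqP.
  rewrite big_ord_recl big_ord1 /phi !cV2E.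
  congr (_ + Uh_act rho (h _) (b _)); exact: val_inj.
pose psi v := xchoose (phi_surj v).
have psiK : cancel psi phi by move=> v; rewrite -(eqP (xchooseP (phi_surj v))).
have phiK : cancel phi psi by move=> f; apply: phi_inj.
pose al i f := psi (rho (e_i1 F i) (phi f)).
pose be i f := psi (rho (e_1i F i) (phi f)).
have phi0 : phi 0 = 0 by apply: (addrI (phi 0)); rewrite -phiD !addr0.
have phiN f : phi (- f) = - phi f.
  by apply/eqP; rewrite -addr_eq0 -phiD addNr phi0.
have alD i : {morph al i : f g / f + g}.
  by move=> f g; apply: phi_inj; rewrite phiD !psiK phiD (rhoD rhoP).
have beD i : {morph be i : f g / f + g}.
  by move=> f g; apply: phi_inj; rewrite phiD !psiK phiD (rhoD rhoP).
have alZ i (p : A) f : al i (p *: f) = Delta_V i p *: al i f.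
  by apply: phi_inj; rewrite phiZ !psiK phiZ (rho_i1_act rhoP).
have beZ i (p : A) f : be i (p *: f) = Delta_ i p *: be i f.
  by apply: phi_inj; rewrite phiZ !psiK phiZ (rho_1i_act rhoP).
have alC i j f : al i (al j f) = - al j (al i f).
  by apply: phi_inj; rewrite phiN !psiK (rho_i1_i1 rhoP).
have beC i j f : be i (be j f) = - be j (be i f).
  by apply: phi_inj; rewrite phiN !psiK (rho_1i_1i rhoP).
have albe i f : al i (be i f) + be i (al i f) = 'X_i *: f.
  apply: phi_inj; rewrite phiD !psiK (rho_i1_1i rhoP) phiZ.
  by rewrite -['X_i]mulr1 (Uh_actX rhoP) -mpolyC1 Uh_actC scale1r.
have [u [w [a [S [span indep a0 alu act]]]]] :=
  rank_two_normal_form m_gt1 char2 alD beD alZ beZ alC beC albe.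
(* This second identification uses the basis [u], [w], in which the odd operators have the
   prescribed matrices; the required action is [rho] transported along [chi]. *)
pose chi (f : polyvec F m) : V := phi (f 0 0 *: u + f 1 0 *: w).
have chiD f g : chi (f + g) = chi f + chi g.
  by rewrite /chi -phiD !mxE !scalerDl addrACA.
have chiM p (f : 'cV[A]_2) : chi (p *: f) = Uh_act rho p (chi f).
  by rewrite /chi -phiZ !mxE scalerDr !scalerA.
have chi_lin : linear chi.
  by move=> c f g; rewrite chiD polyvecZ chiM Uh_actC.
have chi_inj : injective chi.
  move=> f g /phi_inj /eqP; rewrite -subr_eq0 opprD addrACA -!scalerBl.
  move=> /eqP/indep[/eqP + /eqP]; rewrite !subr_eq0 => /eqP e0 /eqP e1.
  exact: cV2_eq.
have chi_surj v : exists f, v == chi f.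
  have [x [y e]] := span (psi v).
  by exists (cV2 x y); rewrite /chi !cV2E -e psiK.
pose xi v := xchoose (chi_surj v).
have xiK : cancel xi chi by move=> v; rewrite -(eqP (xchooseP (chi_surj v))).
have chiK : cancel chi xi by move=> f; apply: chi_inj.
have xi_lin : linear xi by move=> c v w'; apply: chi_inj; rewrite chi_lin !xiK.
exists a, S, (fun x f => xi (rho x (chi f))); split=> //.
  split; first exact: umodule_transport.
  - move=> i f; apply: chi_inj; rewrite xiK chiM.
    by rewrite -['X_i]mulr1 (Uh_actX rhoP) -mpolyC1 Uh_actC scale1r.
  - move=> i f; apply: chi_inj; rewrite xiK /chi -[LHS]psiK -/(al i _).
    congr phi; rewrite alD !alZ (alu i).1 (act i).1 scaler0 add0r.
    by rewrite /E_i1 mul_E01 !cV2E mxE scalerA scale0r addr0 mulrC.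
  - move=> i f; apply: chi_inj; rewrite xiK /chi -[LHS]psiK -/(be i _).
    congr phi; rewrite beD !beZ (alu i).2 (act i).2 scaler0 addr0.
    by rewrite /E_1i mul_E10 !cV2E mxE scalerA scale0r add0r mulrC.
exists (HB.pack_for {linear V -> polyvec F m} xi
  (GRing.isLinear.Build F V (polyvec F m) *:%R xi xi_lin)).
split=> [|x v] /=; first by exists chi.
by rewrite xiK.
Qed.
End Classification.

(** * Actions generated by the odd elements *)

Section LinearFunctions.
Variables (R : pzRingType) (U V : lmodType R) (f : U -> V).
Hypothesis f_lin : linear f.

Lemma linear_op0 : f 0 = 0.
Proof. by apply: (addrI (f 0)); have := f_lin 1 0 0; rewrite !scale1r !addr0. Qed.

Lemma linear_opD : {morph f : v w / v + w}.
Proof. by move=> v w; have := f_lin 1 v w; rewrite !scale1r. Qed.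

Lemma linear_opZ c : {morph f : v / c *: v}.
Proof. by move=> v; have := f_lin c v 0; rewrite linear_op0 !addr0. Qed.

Lemma linear_op_sum (I : finType) (c : I -> R) (G : I -> U) :
  f (\sum_s c s *: G s) = \sum_s c s *: f (G s).
Proof.
rewrite (big_morph f linear_opD linear_op0).
by apply: eq_bigr => s _; rewrite linear_opZ.
Qed.

End LinearFunctions.

Section OperatorModule.
Variables (F : fieldType) (m : nat) (V : lmodType F).
Variables (al be : 'I_m -> V -> V).
Implicit Types (u : 'cV[F]_m) (w : 'rV[F]_m) (M N : 'M[F]_m) (v : V) (i j k l : 'I_m).

(** The operator by which the bracket of [e_i1 i] and [e_1i j] must act. The hypotheses
    [anticomm_al] and [anticomm_be] are the brackets of that even element with the odd
    generators. *)
Definition anticomm i j v := al i (be j v) + be j (al i v).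

Hypothesis al_lin : forall i, linear (al i).
Hypothesis be_lin : forall i, linear (be i).
Hypothesis alal : forall i j v, al i (al j v) + al j (al i v) = 0.
Hypothesis bebe : forall i j v, be i (be j v) + be j (be i v) = 0.
Hypothesis anticomm_al : forall i j k v, anticomm i j (al k v) =
  al k (anticomm i j v) + (j == k)%:R *: al i v - (i == j)%:R *: al k v.
Hypothesis anticomm_be : forall i j k v, anticomm i j (be k v) =
  be k (anticomm i j v) - (i == k)%:R *: be j v + (i == j)%:R *: be k v.

Definition act_ur u v := \sum_i u i 0 *: al i v.
Definition act_dl w v := \sum_j w 0 j *: be j v.
Definition act_ul M v := \sum_i \sum_j M i j *: anticomm i j v.

(* The entry at (od, od) does not occur: it is the trace of the upper left block. *)
Definition gen_act (x : sl F m) v :=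
  act_ul (ulsubmx (sl_val x)) v + act_ur (ursubmx (sl_val x)) v
  + act_dl (dlsubmx (sl_val x)) v.

Lemma anticomm_lin i j : linear (anticomm i j).
Proof.
move=> c v w; rewrite /anticomm be_lin al_lin al_lin be_lin scalerDr.
by rewrite addrACA.
Qed.

Lemma sum_lin (I : finType) (f : I -> V -> V) (c : I -> F) :
  (forall s, linear (f s)) -> linear (fun v => \sum_s c s *: f s v).
Proof.
move=> fl d v w; rewrite scaler_sumr -big_split; apply: eq_bigr => i _ /=.
by rewrite fl scalerDr !scalerA [c i * d]mulrC.
Qed.

Lemma act_ur_lin u : linear (act_ur u).
Proof. exact: sum_lin. Qed.

Lemma act_dl_lin w : linear (act_dl w).
Proof. exact: sum_lin. Qed.

Lemma act_ul_lin M : linear (act_ul M).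
Proof.
move=> d v w; rewrite /act_ul scaler_sumr -big_split; apply: eq_bigr => i _ /=.
by apply: sum_lin => j; apply: anticomm_lin.
Qed.

Lemma act_ur_linl v : linear (act_ur^~ v).
Proof.
move=> c u u'; rewrite /act_ur scaler_sumr -big_split; apply: eq_bigr => i _ /=.
by rewrite !mxE scalerDl scalerA.
Qed.

Lemma act_dl_linl v : linear (act_dl^~ v).
Proof.
move=> c u u'; rewrite /act_dl scaler_sumr -big_split; apply: eq_bigr => i _ /=.
by rewrite !mxE scalerDl scalerA.
Qed.

Lemma act_ul_linl v : linear (act_ul^~ v).
Proof.
move=> c M N; rewrite /act_ul scaler_sumr -big_split; apply: eq_bigr => i _ /=.
rewrite scaler_sumr -big_split; apply: eq_bigr => j _ /=.
by rewrite !mxE scalerDl scalerA.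
Qed.

Lemma ur_ur u u' v : act_ur u (act_ur u' v) + act_ur u' (act_ur u v) = 0.
Proof.
have E s t : act_ur s (act_ur t v) = \sum_i \sum_j (s i 0 * t j 0) *: al i (al j v).
  apply: eq_bigr => i _; rewrite linear_op_sum // scaler_sumr.
  by apply: eq_bigr => j _; rewrite scalerA.
rewrite E [act_ur u' _]E [X in _ + X]exchange_big -big_split big1 // => i _.
rewrite -big_split big1 // => j _ /=.
by rewrite [u' _ _ * _]mulrC -scalerDr alal scaler0.
Qed.

Lemma dl_dl w w' v : act_dl w (act_dl w' v) + act_dl w' (act_dl w v) = 0.
Proof.
have E s t : act_dl s (act_dl t v) = \sum_i \sum_j (s 0 i * t 0 j) *: be i (be j v).
  apply: eq_bigr => i _; rewrite linear_op_sum // scaler_sumr.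
  by apply: eq_bigr => j _; rewrite scalerA.
rewrite E [act_dl w' _]E [X in _ + X]exchange_big -big_split big1 // => i _.
rewrite -big_split big1 // => j _ /=.
by rewrite [w' _ _ * _]mulrC -scalerDr bebe scaler0.
Qed.

Lemma ur_dl u w v : act_ur u (act_dl w v) + act_dl w (act_ur u v) = act_ul (u *m w) v.
Proof.
have -> : act_ur u (act_dl w v) = \sum_i \sum_j (u i 0 * w 0 j) *: al i (be j v).
  apply: eq_bigr => i _; rewrite linear_op_sum // scaler_sumr.
  by apply: eq_bigr => j _; rewrite scalerA.
have -> : act_dl w (act_ur u v) = \sum_i \sum_j (u i 0 * w 0 j) *: be j (al i v).
  rewrite exchange_big; apply: eq_bigr => i _; rewrite linear_op_sum // scaler_sumr.
  by apply: eq_bigr => j _; rewrite scalerA mulrC.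
rewrite -big_split; apply: eq_bigr => i _; rewrite -big_split; apply: eq_bigr => j _ /=.
by rewrite -scalerDr mxE big_ord1.
Qed.

Lemma sum_delta (I : finType) (f : I -> V) (s : I) : \sum_t (t == s)%:R *: f t = f s.
Proof.
rewrite (bigD1 s) //= eqxx scale1r big1 ?addr0 // => t /negPf ->.
by rewrite scale0r.
Qed.

Lemma ul_al M k v :
  act_ul M (al k v) = al k (act_ul M v) + \sum_i M i k *: al i v - \tr M *: al k v.
Proof.
have -> : al k (act_ul M v) = \sum_i \sum_j M i j *: al k (anticomm i j v).
  rewrite /act_ul (big_morph _ (linear_opD (al_lin k)) (linear_op0 (al_lin k))).
  by apply: eq_bigr => i _; rewrite linear_op_sum.
rewrite /mxtrace scaler_suml -big_split -sumrB; apply: eq_bigr => i _ /=.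
under eq_bigr => j _ do rewrite anticomm_al scalerBr scalerDr.
rewrite sumrB big_split /=; congr (_ + _ - _).
  rewrite -(sum_delta (fun j => M i j *: al i v) k).
  by apply: eq_bigr => j _; rewrite !scalerA mulrC.
rewrite -(sum_delta (fun j => M i j *: al k v) i).
by apply: eq_bigr => j _; rewrite !scalerA mulrC eq_sym.
Qed.

Lemma ul_be M k v :
  act_ul M (be k v) = be k (act_ul M v) - \sum_j M k j *: be j v + \tr M *: be k v.
Proof.
have -> : be k (act_ul M v) = \sum_i \sum_j M i j *: be k (anticomm i j v).
  rewrite /act_ul (big_morph _ (linear_opD (be_lin k)) (linear_op0 (be_lin k))).
  by apply: eq_bigr => i _; rewrite linear_op_sum.
have -> : \sum_j M k j *: be j v = \sum_i \sum_j ((i == k)%:R * M i j) *: be j v.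
  rewrite -(sum_delta (fun i => \sum_j M i j *: be j v) k); apply: eq_bigr => i _.
  by rewrite scaler_sumr; apply: eq_bigr => j _; rewrite scalerA.
rewrite /mxtrace scaler_suml -sumrB -big_split; apply: eq_bigr => i _ /=.
under eq_bigr => j _ do rewrite anticomm_be scalerDr scalerBr.
rewrite big_split sumrB /=; congr (_ - _ + _).
  by apply: eq_bigr => j _; rewrite !scalerA mulrC.
rewrite -(sum_delta (fun j => M i j *: be k v) i).
by apply: eq_bigr => j _; rewrite !scalerA mulrC eq_sym.
Qed.

(** The correction is the upper right block of the bracket of the block diagonal matrix with blocks
    [M] and [\tr M] with the column [u]. *)
Lemma ul_ur M u v :
  act_ul M (act_ur u v) = act_ur u (act_ul M v) + act_ur (M *m u - \tr M *: u) v.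
Proof.
rewrite {1}/act_ur linear_op_sum; last exact: act_ul_lin.
have -> : act_ur (M *m u - \tr M *: u) v =
    \sum_k u k 0 *: (\sum_i M i k *: al i v - \tr M *: al k v).
  under [RHS]eq_bigr => k _ do rewrite scalerBr scaler_sumr.
  rewrite sumrB exchange_big -sumrB; apply: eq_bigr => i _ /=.
  rewrite !mxE scalerBl scaler_suml scalerA [u i 0 * _]mulrC; congr (_ - _).
  by apply: eq_bigr => k _; rewrite scalerA mulrC.
rewrite -big_split; apply: eq_bigr => k _ /=.
by rewrite ul_al -addrA scalerDr.
Qed.

Lemma ul_dl M w v :
  act_ul M (act_dl w v) = act_dl w (act_ul M v) + act_dl (\tr M *: w - w *m M) v.
Proof.
rewrite {1}/act_dl linear_op_sum; last exact: act_ul_lin.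
have -> : act_dl (\tr M *: w - w *m M) v =
    \sum_k w 0 k *: (\tr M *: be k v - \sum_j M k j *: be j v).
  under [RHS]eq_bigr => k _ do rewrite scalerBr scaler_sumr.
  rewrite sumrB exchange_big -sumrB; apply: eq_bigr => i _ /=.
  rewrite !mxE scalerBl scaler_suml scalerA [w 0 i * _]mulrC; congr (_ - _).
  by apply: eq_bigr => k _; rewrite scalerA.
rewrite -big_split; apply: eq_bigr => k _ /=.
by rewrite ul_be -addrA [- _ + _]addrC scalerDr.
Qed.

(** Move [act_ul M] past [al k] and [be l] in turn: the trace terms produced by the two have
    opposite signs and cancel. *)
Lemma ul_anticomm M k l v : act_ul M (anticomm k l v) =
  anticomm k l (act_ul M v) + (\sum_i M i k *: anticomm i l v - \sum_j M l j *: anticomm k j v).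
Proof.
rewrite {1}/anticomm (linear_opD (act_ul_lin M)) ul_al !ul_be ul_al.
rewrite !(linear_opD (al_lin k)) !(linear_opD (be_lin l)).
have alN f : al k (- f) = - al k f by rewrite -scaleN1r (linear_opZ (al_lin k)) scaleN1r.
have beN f : be l (- f) = - be l f by rewrite -scaleN1r (linear_opZ (be_lin l)) scaleN1r.
rewrite !(alN, beN) !(linear_op_sum (al_lin k)) !(linear_op_sum (be_lin l)).
rewrite (linear_opZ (al_lin k)) (linear_opZ (be_lin l)).
under [X in _ = _ + (X - _)]eq_bigr => i _ do rewrite scalerDr.
under [X in _ = _ + (_ - X)]eq_bigr => i _ do rewrite scalerDr.
rewrite !big_split /= {1}/anticomm.
(* Only an additive rearrangement remains, so all terms are generalized; [x7] and [x8] are the trace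
   terms. *)
move: (al k (be l _)) (be l (al k (act_ul M v))) (\sum_i _) (\sum_i _)
  (\sum_i _) (\sum_i _) (\tr M *: _) (\tr M *: _).
move=> x1 x2 x3 x4 x5 x6 x7 x8.
rewrite [x1 - x6 + x8 + x5]addrAC addrK (addrAC _ (- x3) x7) subrK.
by rewrite opprD [x5 + x4 + _]addrACA [RHS]addrACA [x1 - x6 + x5]addrAC !addrA.
Qed.

Lemma ul_ul M N v :
  act_ul M (act_ul N v) = act_ul N (act_ul M v) + act_ul (M *m N - N *m M) v.
Proof.
have -> : act_ul M (act_ul N v) = \sum_k \sum_l N k l *: act_ul M (anticomm k l v).
  rewrite {2}/act_ul (big_morph _ (linear_opD (act_ul_lin M)) (linear_op0 (act_ul_lin M))).
  by apply: eq_bigr => k _; rewrite linear_op_sum //; apply: act_ul_lin.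
have -> : act_ul (M *m N - N *m M) v = act_ul (M *m N) v - act_ul (N *m M) v.
  by rewrite [M *m N - _]addrC -[- (N *m M)]scaleN1r (act_ul_linl v) scaleN1r addrC.
have -> : act_ul (M *m N) v = \sum_k \sum_l N k l *: \sum_i M i k *: anticomm i l v.
  rewrite exchange_big /= [LHS]exchange_big; apply: eq_bigr => l _.
  under [RHS]eq_bigr => k _ do rewrite scaler_sumr.
  rewrite exchange_big; apply: eq_bigr => i _; rewrite mxE scaler_suml.
  by apply: eq_bigr => k _; rewrite scalerA mulrC.
have -> : act_ul (N *m M) v = \sum_k \sum_l N k l *: \sum_j M l j *: anticomm k j v.
  apply: eq_bigr => k _; under [RHS]eq_bigr => l _ do rewrite scaler_sumr.
  rewrite exchange_big; apply: eq_bigr => j _; rewrite mxE scaler_suml.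
  by apply: eq_bigr => l _; rewrite scalerA.
rewrite -sumrB -big_split; apply: eq_bigr => k _ /=.
rewrite -sumrB -big_split; apply: eq_bigr => l _ /=.
by rewrite ul_anticomm -scalerBr -scalerDr.
Qed.

Lemma even_block (x : sl F m) : has_parity false (sl_val x) ->
  exists M, sl_val x = block_mx M 0 0 (\tr M)%:M.
Proof.
move=> px; exists (ulsubmx (sl_val x)); rewrite -[LHS]px; congr block_mx.
have := sl_valP x; rewrite unfold_in /str subr_eq0 => /eqP ->.
by apply/matrixP => i j; rewrite /mxtrace big_ord1 !ord1 !mxE eqxx.
Qed.

Lemma odd_block (x : sl F m) : has_parity true (sl_val x) ->
  exists u w, sl_val x = block_mx 0 u w 0.
Proof.
by move=> px; exists (ursubmx (sl_val x)), (dlsubmx (sl_val x)); rewrite -[LHS]px.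
Qed.

Lemma gen_act_block (x : sl F m) M u w d v : sl_val x = block_mx M u w d ->
  gen_act x v = act_ul M v + act_ur u v + act_dl w v.
Proof. by rewrite /gen_act => ->; rewrite block_mxKul block_mxKur block_mxKdl. Qed.

Lemma gen_act_linl v : linear (gen_act^~ v).
Proof.
move=> c x y; have e : sl_val (c *: x + y) = c *: sl_val x + sl_val y by [].
rewrite /gen_act e.
rewrite /ulsubmx /dlsubmx /ursubmx !linearP /=.
rewrite (act_ul_linl v) (act_ur_linl v) (act_dl_linl v) !scalerDr.
by rewrite [RHS]addrACA; congr (_ + _); rewrite addrACA.
Qed.

Lemma gen_act_linr x : linear (gen_act x).
Proof.
move=> c v w; rewrite /gen_act act_ul_lin act_ur_lin act_dl_lin !scalerDr.
by rewrite [RHS]addrACA; congr (_ + _); rewrite addrACA.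
Qed.

(** Homogeneous elements are block diagonal or block antidiagonal, so the bracket splits by parity:
    odd pairs use [ur_ur], [dl_dl] and [ur_dl], mixed pairs [ul_ur] and [ul_dl], even pairs
    [ul_ul]. *)
Lemma gen_act_umodule : is_umodule gen_act.
Proof.
split; [exact: gen_act_linl | exact: gen_act_linr |].
have ul0 v : act_ul 0 v = 0.
  by have := act_ul_linl v (- 1) 0 0; rewrite scaler0 addr0 scaleN1r addNr.
have ur0 v : act_ur 0 v = 0.
  by have := act_ur_linl v (- 1) 0 0; rewrite scaler0 addr0 scaleN1r addNr.
have dl0 v : act_dl 0 v = 0.
  by have := act_dl_linl v (- 1) 0 0; rewrite scaler0 addr0 scaleN1r addNr.
have urN u v : act_ur (- u) v = - act_ur u v.
  by have := act_ur_linl v (- 1) u 0; rewrite ur0 !addr0 !scaleN1r.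
have dlN w v : act_dl (- w) v = - act_dl w v.
  by have := act_dl_linl v (- 1) w 0; rewrite dl0 !addr0 !scaleN1r.
have ulD M N v : act_ul (M + N) v = act_ul M v + act_ul N v.
  by have := act_ul_linl v 1 M N; rewrite !scale1r.
move=> p q x y v px qy.
move: (mx_sbracketE px qy : sl_val (sbracket x y) = _) => e; move: px qy e.
case: p q => [] [] px qy e.
- have [u [w xE]] := odd_block px; have [u' [w' yE]] := odd_block qy.
  rewrite xE yE !mulmx_block expr1 scaleN1r opprK add_block_mx in e.
  rewrite !(mul0mx, mulmx0, addr0, add0r) in e.
  rewrite (gen_act_block _ e) !(gen_act_block _ xE) !(gen_act_block _ yE).
  rewrite !(ul0, ur0, dl0, addr0, add0r) expr1 scaleN1r opprK ulD -!ur_dl.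
  rewrite !(linear_opD (act_ur_lin _)) !(linear_opD (act_dl_lin _)).
  rewrite [RHS]addrACA [X in _ = X + _]addrACA [X in _ = _ + X]addrACA.
  by rewrite ur_ur dl_dl add0r addr0 addrACA [X in _ + X]addrC.
- have [u [w xE]] := odd_block px; have [M yE] := even_block qy.
  rewrite xE yE !mulmx_block expr0 scale1r opp_block_mx add_block_mx in e.
  rewrite !(mul0mx, mulmx0, addr0, add0r, oppr0) mul_mx_scalar mul_scalar_mx in e.
  rewrite (gen_act_block _ e) !(gen_act_block _ xE) !(gen_act_block _ yE).
  rewrite !(ul0, ur0, dl0, addr0, add0r) expr0 scale1r.
  rewrite (linear_opD (act_ul_lin _)) ul_ur ul_dl -[_ - M *m u]opprB urN.
  by rewrite -[_ - \tr M *: w]opprB dlN [X in _ = _ - X]addrACA opprD addrA subrr add0r opprD.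
- have [M xE] := even_block px; have [u [w yE]] := odd_block qy.
  rewrite xE yE !mulmx_block expr0 scale1r opp_block_mx add_block_mx in e.
  rewrite !(mul0mx, mulmx0, addr0, add0r, oppr0) mul_mx_scalar mul_scalar_mx in e.
  rewrite (gen_act_block _ e) !(gen_act_block _ xE) !(gen_act_block _ yE).
  rewrite !(ul0, ur0, dl0, addr0, add0r) expr0 scale1r.
  by rewrite (linear_opD (act_ul_lin _)) ul_ur ul_dl addrACA [RHS]addrC addKr.
have [M xE] := even_block px; have [N yE] := even_block qy.
rewrite xE yE !mulmx_block expr0 scale1r opp_block_mx add_block_mx in e.
rewrite !(mul0mx, mulmx0, addr0, add0r, oppr0) in e.
rewrite (gen_act_block _ e) !(gen_act_block _ xE) !(gen_act_block _ yE).
by rewrite !(ur0, dl0, addr0) expr0 scale1r ul_ul [RHS]addrC addKr.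
Qed.

Lemma gen_act_i1 i v : gen_act (e_i1 F i) v = al i v.
Proof.
rewrite /gen_act /= -[RHS](sum_delta (al^~ v)) -[RHS]addr0 -[X in _ = X + _]add0r.
rewrite /act_ul /act_ur /act_dl; congr (_ + _ + _).
- rewrite big1 // => k _; rewrite big1 // => l _.
  by rewrite !mxE eq_lrshift andbF scale0r.
- by apply: eq_bigr => k _; rewrite !mxE eq_lshift eqxx andbT.
- by rewrite big1 // => k _; rewrite !mxE eq_rlshift scale0r.
Qed.

Lemma gen_act_1i i v : gen_act (e_1i F i) v = be i v.
Proof.
rewrite /gen_act /= -[RHS](sum_delta (be^~ v)) -[RHS]add0r -[X in _ = X + _](addr0 0).
rewrite /act_ul /act_ur /act_dl; congr (_ + _ + _).
- rewrite big1 // => k _; rewrite big1 // => l _.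
  by rewrite !mxE eq_lrshift scale0r.
- by rewrite big1 // => k _; rewrite !mxE eq_lrshift scale0r.
- by apply: eq_bigr => k _; rewrite !mxE eq_lshift eqxx.
Qed.

End OperatorModule.

(** * Generation of sl(m|1) by the odd elements *)

Section Generators.
Variables (F : fieldType) (m : nat).

Lemma sl_valB_i1_1i (i j : 'I_m) : sl_val (sbracket (e_i1 F i) (e_1i F j)) =
  delta_mx (ev i) (ev j) + (i == j)%:R *: delta_mx (od m) (od m).
Proof.
rewrite /= (mx_sbracketE (parity_i1 F i) (parity_1i F j)) expr1 scaleN1r opprK /=.
by rewrite !deltaE eq_sym scaler_nat.
Qed.

Lemma mx_ext (X Y : 'M[F]_(m + 1)) :
  (forall i j, X (ev i) (ev j) = Y (ev i) (ev j)) ->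
  (forall i, X (ev i) (od m) = Y (ev i) (od m)) ->
  (forall i, X (od m) (ev i) = Y (od m) (ev i)) ->
  X (od m) (od m) = Y (od m) (od m) -> X = Y.
Proof.
move=> H1 H2 H3 H4; apply/matrixP => i j.
have split_od k : (exists k', k = ev k') \/ k = od m.
  rewrite -[k]splitK; case: (split k) => k' /=; [by left; exists k' | right].
  by rewrite /od ord1.
case: (split_od i) => [[i' ->]|->]; case: (split_od j) => [[j' ->]|->];
  [exact: H1 | exact: H2 | exact: H3 | exact: H4].
Qed.

(** All entries except the one at [(od, od)] can be read off directly. There the brackets contribute
    the trace of the even block, which is the right value because the supertrace vanishes. *)
Lemma sl_generators (x : sl F m) : x =
  \sum_i \sum_j sl_val x (ev i) (ev j) *: sbracket (e_i1 F i) (e_1i F j)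
  + \sum_i sl_val x (ev i) (od m) *: e_i1 F i
  + \sum_i sl_val x (od m) (ev i) *: e_1i F i.
Proof.
apply: sl_inj.
have sum_val (I : finType) (c : I -> F) (y : I -> sl F m) :
    sl_val (\sum_s c s *: y s) = \sum_s c s *: sl_val (y s).
  by rewrite (linear_op_sum (f := @sl_val F m)).
have sumD (I : finType) (y : I -> sl F m) : sl_val (\sum_s y s) = \sum_s sl_val (y s).
  by apply: (big_morph (@sl_val F m)).
rewrite !sl_valD !sum_val sumD.
under eq_bigr => i _ do (rewrite sum_val; under eq_bigr => j _ do rewrite sl_valB_i1_1i).
set X := sl_val x.
have pick k (f : 'I_m -> F) : \sum_s f s * (k == s)%:R = f k.
  rewrite (bigD1 k) //= eqxx mulr1 big1 ?addr0 // => s.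
  by rewrite eq_sym => /negPf ->; rewrite mulr0.
apply: mx_ext => [k l|k|k|].
- rewrite !mxE !summxE.
  rewrite [X in _ + X + _]big1 ?addr0 => [|s _]; last by rewrite !mxE !deltaE andbF mulr0.
  rewrite [X in _ + X]big1 ?addr0 => [|s _]; last by rewrite !mxE !deltaE mulr0.
  rewrite -(pick k (fun i => X (ev i) (ev l))); apply: eq_bigr => i _.
  rewrite summxE -(pick l (fun j => X (ev i) (ev j))) mulr_suml; apply: eq_bigr => j _.
  by rewrite !mxE !deltaE mulr0 addr0 -mulrA -natrM mulnb andbC.
- rewrite !mxE !summxE [X in X + _ + _]big1 => [|i _]; last first.
    by rewrite summxE big1 // => j _; rewrite !mxE !deltaE andbF mulr0 addr0 mulr0.
  rewrite [X in _ + _ + X]big1 ?addr0 ?add0r => [|s _]; last by rewrite !mxE !deltaE mulr0.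
  rewrite -(pick k (fun i => X (ev i) (od m))); apply: eq_bigr => i _.
  by rewrite !mxE !deltaE andbT.
- rewrite !mxE !summxE [X in X + _ + _]big1 => [|i _]; last first.
    by rewrite summxE big1 // => j _; rewrite !mxE !deltaE mulr0 addr0 mulr0.
  rewrite [X in _ + X + _]big1 ?add0r => [|s _]; last by rewrite !mxE !deltaE mulr0.
  rewrite -(pick k (fun i => X (od m) (ev i))); apply: eq_bigr => i _.
  by rewrite !mxE !deltaE.
rewrite !mxE !summxE [X in _ + X + _]big1 => [|s _]; last by rewrite !mxE !deltaE mulr0.
rewrite [X in _ + X]big1 ?addr0 => [|s _]; last by rewrite !mxE !deltaE mulr0.
have := sl_valP x; rewrite unfold_in /str subr_eq0 /mxtrace big_ord1 => /eqP.
rewrite !mxE [X in rshift m X]ord1 -/X => {1}<-; apply: eq_bigr => i _.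
rewrite summxE !mxE -/(ev i) -(pick i (fun j => X (ev i) (ev j))); apply: eq_bigr => j _.
by rewrite !mxE !deltaE add0r mulr1.
Qed.

(** An action is recovered from its odd generators; this yields the uniqueness of the structure on
    M(a, S). *)
Lemma gen_act_unique (V : lmodType F) (rho : sl F m -> V -> V) : is_umodule rho ->
  forall x v, rho x v = gen_act (fun i => rho (e_i1 F i)) (fun i => rho (e_1i F i)) x v.
Proof.
move=> rhoP x v; rewrite {1}(sl_generators x) !(rhoDl rhoP).
have lin := umod_linearl rhoP v.
rewrite !(linear_op_sum lin); congr (_ + _ + _).
- rewrite (big_morph (rho^~ v) (linear_opD lin) (linear_op0 lin)).
  apply: eq_bigr => i _; rewrite (linear_op_sum lin); apply: eq_bigr => j _.
  rewrite /anticomm (umod_bracket rhoP v (parity_i1 F i) (parity_1i F j)).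
  by rewrite expr1 scaleN1r opprK !mxE.
- by apply: eq_bigr => i _; rewrite !mxE /od [ord0]ord1.
- by rewrite /act_dl; apply: eq_bigr => i _; rewrite !mxE /od [ord0]ord1.
Qed.

End Generators.

(** * The modules M(a, S) *)

Section CoefficientIdentities.
Variables (I : eqType) (B : comPzRingType) (D DV : I -> B -> B) (P Q dP dQ : I -> B).
Hypothesis D_M : forall i, {morph D i : x y / x * y}.
Hypothesis DV_M : forall i, {morph DV i : x y / x * y}.
Hypothesis D_K : forall i, cancel (D i) (DV i).
Hypothesis DV_K : forall i, cancel (DV i) (D i).
Hypothesis D_P : forall i j, D i (P j) = P j - (j != i)%:R * dP j.
Hypothesis D_Q : forall i j, D i (Q j) = Q j - (j != i)%:R * dQ j.
Hypothesis DV_P : forall i j, DV i (P j) = P j + (j != i)%:R * dP j.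
Hypothesis DV_Q : forall i j, DV i (Q j) = Q j + (j != i)%:R * dQ j.
Hypothesis DVD_P : forall i j k, k != i -> k != j -> DV i (D j (P k)) = P k.
Hypothesis DDV_Q : forall i j k, k != i -> k != j -> D i (DV j (Q k)) = Q k.
Hypothesis DV_D_DV : forall i j k g, DV i (D j (DV k g)) = DV k (D j (DV i g)).
Hypothesis D_DV_D : forall i j k g, D i (DV j (D k g)) = D k (DV j (D i g)).
Hypothesis PQ_plus : forall i, (P i + dP i) * (Q i + dQ i) = P i * Q i + 1.
Hypothesis PQ_minus : forall i, (P i - dP i) * (Q i - dQ i) = P i * Q i - 1.

(** For [i = k] the corrections cancel. If exactly one of [i], [k] equals [j], adjacent inverse
    shifts cancel on either side, and [PQ_plus] supplies the extra term. For distinct indices, the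
    coefficients on both sides agree and the shifts can be reordered by [DV_D_DV]. *)
Lemma coef_i1_1i_i1 i j k g :
  P i * DV i (Q j * D j (P k * DV k g)) =
  P k * DV k (Q j * D j (P i * DV i g))
  + (j == k)%:R * (P i * DV i g) - (i == j)%:R * (P k * DV k g).
Proof.
have [->|ik] := eqVneq i k; first by rewrite [k == j]eq_sym addrK.
have lem l l' h : l != l' -> P l * DV l (Q l' * D l' (P l' * DV l' h)) =
    P l' * DV l' (Q l' * D l' (P l * DV l h)) + P l * DV l h.
  move=> ll'; rewrite (D_M l' (P l')) DV_K D_P eqxx mul0r subr0.
  rewrite !DV_M D_K !DV_Q !DV_P eqxx [l' == l]eq_sym ll' /= mul0r addr0 !mul1r.
  rewrite [_ * ((P l' + _) * _)]mulrA [(Q l' + _) * _]mulrC PQ_plus; ring.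
have [->|jk] := eqVneq j k.
  by rewrite (negPf ik) mul0r subr0 mul1r lem.
have [<-|ij] := eqVneq i j.
  by rewrite mul0r addr0 mul1r lem 1?eq_sym // addrK.
rewrite !mul0r addr0 subr0 !D_M !DV_M !DVD_P ?[k == j]eq_sym // 1?eq_sym //.
by rewrite !DV_Q [j == i]eq_sym ij jk DV_D_DV; ring.
Qed.

(** The mirror computation, with [PQ_minus] supplying the corrections. *)
Lemma coef_1i_i1_1i i j k g :
  Q j * D j (P i * DV i (Q k * D k g)) =
  Q k * D k (P i * DV i (Q j * D j g))
  - (i == k)%:R * (Q j * D j g) + (i == j)%:R * (Q k * D k g).
Proof.
have [->|jk] := eqVneq j k; first by rewrite subrK.
have lem l l' h : l != l' -> Q l * D l (P l' * DV l' (Q l' * D l' h)) =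
    Q l' * D l' (P l' * DV l' (Q l * D l h)) - Q l * D l h.
  move=> ll'; rewrite (DV_M l' (Q l')) D_K DV_Q eqxx mul0r addr0.
  rewrite !D_M DV_K !D_Q !D_P eqxx [l' == l]eq_sym ll' /= mul0r subr0 !mul1r.
  rewrite [_ * ((Q l' - _) * _)]mulrA PQ_minus; ring.
have [->|ik] := eqVneq i k.
  by rewrite [k == j]eq_sym (negPf jk) mul0r addr0 mul1r lem.
have [->|ij] := eqVneq i j.
  by rewrite mul0r subr0 mul1r lem 1?eq_sym // subrK.
rewrite !mul0r addr0 subr0 !DV_M !D_M !DDV_Q ?[k == i]eq_sym ?[j == i]eq_sym // 1?eq_sym //.
by rewrite !D_P ij ik D_DV_D; ring.
Qed.

End CoefficientIdentities.

(** * Modules built from antidiagonal operators on pairs *)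

Section AntidiagonalOperators.
Variables (F : fieldType) (m : nat).
Local Notation A := {mpoly F[m]}.
Variables (s t : 'I_m -> A -> A).
Implicit Types f g : polyvec F m.
Hypothesis s_lin : forall i, linear (s i).
Hypothesis t_lin : forall i, linear (t i).
Hypothesis sts : forall i j k p, s i (t j (s k p)) =
  s k (t j (s i p)) + (j == k)%:R *: s i p - (i == j)%:R *: s k p.
Hypothesis tst : forall i j k p, t j (s i (t k p)) =
  t k (s i (t j p)) - (i == k)%:R *: t j p + (i == j)%:R *: t k p.
Hypothesis st : forall i p, s i (t i p) = 'X_i * p.
Hypothesis ts : forall i p, t i (s i p) = 'X_i * p.

Definition upper i f : polyvec F m := cV2 (s i (f 1 0)) 0.
Definition lower i f : polyvec F m := cV2 0 (t i (f 0 0)).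

Lemma polyvecE (c : F) f g (l : 'I_2) : (c *: f + g) l 0 = c *: f l 0 + g l 0.
Proof. by rewrite !mxE. Qed.

Lemma cV2_scale (c : F) (x y : A) : (c *: (cV2 x y : polyvec F m)) = cV2 (c *: x) (c *: y).
Proof. by apply: cV2_eq; rewrite !mxE. Qed.

Lemma cV2D (x y z w : A) : cV2 x y + cV2 z w = cV2 (x + z) (y + w).
Proof. by apply: cV2_eq; rewrite !mxE. Qed.

Lemma cV2N (x y : A) : - cV2 x y = cV2 (- x) (- y).
Proof. by apply: cV2_eq; rewrite !mxE. Qed.

Lemma upper_lin i : linear (upper i).
Proof. by move=> c f g; rewrite cV2_scale cV2D scaler0 addr0 -s_lin -polyvecE. Qed.

Lemma lower_lin i : linear (lower i).
Proof. by move=> c f g; rewrite cV2_scale cV2D scaler0 addr0 -t_lin -polyvecE. Qed.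

Lemma anticomm_upper_lower i j f :
  anticomm upper lower i j f = cV2 (s i (t j (f 0 0))) (t j (s i (f 1 0))).
Proof. by rewrite /anticomm /upper /lower !cV2E cV2D addr0 add0r. Qed.

(** Products of two [upper] or of two [lower] operators vanish, while the mixed anticommutators are
    diagonal, with entries [s i (t j _)] and [t j (s i _)]. The relations thus reduce to [sts] and
    [tst]. *)
Lemma antidiagonal_umodule : is_umodule (gen_act upper lower).
Proof.
have s0 i : s i 0 = 0 by apply/linear_op0/s_lin.
have t0 i : t i 0 = 0 by apply/linear_op0/t_lin.
have cV20 : cV2 0 0 = 0 :> 'cV[A]_2 by apply: cV2_eq; rewrite !mxE.
apply: gen_act_umodule; [exact: upper_lin | exact: lower_lin | | | |].
- by move=> i j f; rewrite /upper !cV2E !s0 cV2D addr0 cV20.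
- by move=> i j f; rewrite /lower !cV2E !t0 cV2D addr0 cV20.
- move=> i j k f; rewrite !anticomm_upper_lower /upper !cV2E s0 t0.
  by rewrite !cV2_scale !scaler0 cV2N !cV2D subr0 addr0 -sts.
- move=> i j k f; rewrite !anticomm_upper_lower /lower !cV2E t0 s0.
  by rewrite !cV2_scale !scaler0 cV2N !cV2D subr0 addr0 -tst.
Qed.

Lemma antidiagonal_h i f : gen_act upper lower (h_ F i) f = 'X_i *: (f : 'cV[A]_2).
Proof.
rewrite -(rho_i1_1i antidiagonal_umodule) !(gen_act_i1, gen_act_1i);
  try exact: upper_lin; try exact: lower_lin.
rewrite -/(anticomm upper lower i i f) anticomm_upper_lower st ts.
by apply: cV2_eq; rewrite cV2E mxE.
Qed.

End AntidiagonalOperators.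

(** * The coefficients of M(a, S) and their relations *)

Section MasOperators.
Variables (F : fieldType) (m : nat) (a : 'I_m -> F) (S : {set 'I_m}).
Hypothesis a0 : forall i, a i != 0.
Local Notation A := {mpoly F[m]}.
Implicit Types (i j k : 'I_m) (g : A).

Definition coef_i1 i : A := if i \in S then a i *: 'X_i else (a i)%:MP.
Definition coef_1i i : A := if i \in S then ((a i)^-1)%:MP else (a i)^-1 *: 'X_i.
(** The slope of [coef_i1 i], an affine function of ['X_i]. *)
Definition dcoef_i1 i : F := if i \in S then a i else 0.
Definition dcoef_1i i : F := if i \in S then 0 else (a i)^-1.

Local Notation P := coef_i1.
Local Notation Q := coef_1i.
Local Notation dP := (fun i => (dcoef_i1 i)%:MP : A).
Local Notation dQ := (fun i => (dcoef_1i i)%:MP : A).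

Lemma shiftZ c (x : F) g : shift c (x *: g) = x *: shift c g.
Proof. exact: comp_mpolyZ. Qed.

Lemma shift_coef_i1 c i : shift c (P i) = P i + (c i)%:MP * dP i.
Proof.
rewrite /coef_i1 /dcoef_i1; case: ifP => _; last by rewrite shiftC mpolyC0 mulr0 addr0.
by rewrite -!mul_mpolyC shiftM shiftC shiftX; ring.
Qed.

Lemma shift_coef_1i c i : shift c (Q i) = Q i + (c i)%:MP * dQ i.
Proof.
rewrite /coef_1i /dcoef_1i; case: ifP => _; first by rewrite shiftC mpolyC0 mulr0 addr0.
by rewrite -!mul_mpolyC shiftM shiftC shiftX; ring.
Qed.

Lemma coefM i : P i * Q i = 'X_i.
Proof.
rewrite /coef_i1 /coef_1i; case: ifP => _; rewrite -!mul_mpolyC.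
  by rewrite mulrAC -mpolyCM divff // mpolyC1 mul1r.
by rewrite mulrA -mpolyCM divff // mpolyC1 mul1r.
Qed.

(** This is the product rule for [P i * Q i = 'X_i]; one of the two factors is constant, so one
    slope is zero. *)
Lemma dcoefM i : P i * dQ i + dP i * Q i = 1 /\ dP i * dQ i = 0.
Proof.
rewrite /coef_i1 /coef_1i /dcoef_i1 /dcoef_1i; case: ifP => _.
  by rewrite mpolyC0 !mulr0 add0r -mpolyCM divff // mpolyC1.
by rewrite mpolyC0 !mul0r addr0 -mpolyCM divff // mpolyC1.
Qed.

Lemma coefM_plus i : (P i + dP i) * (Q i + dQ i) = P i * Q i + 1.
Proof.
have [e1 e2] := dcoefM i; rewrite -e1.
have -> : (P i + dP i) * (Q i + dQ i) = P i * Q i + (P i * dQ i + dP i * Q i) + dP i * dQ i by ring.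
by rewrite e2 addr0.
Qed.

Lemma coefM_minus i : (P i - dP i) * (Q i - dQ i) = P i * Q i - 1.
Proof.
have [e1 e2] := dcoefM i; rewrite -e1.
have -> : (P i - dP i) * (Q i - dQ i) = P i * Q i - (P i * dQ i + dP i * Q i) + dP i * dQ i by ring.
by rewrite e2 addr0.
Qed.

Lemma Delta_M i p q : @Delta_ F m i (p * q) = Delta_ i p * Delta_ i q.
Proof. by rewrite !Delta_E shiftM. Qed.

Lemma Delta_VM i p q : @Delta_V F m i (p * q) = Delta_V i p * Delta_V i q.
Proof. by rewrite !Delta_VE shiftM. Qed.

Lemma Delta_i1 i j : Delta_ i (P j) = P j - (j != i)%:R * dP j.
Proof.
rewrite Delta_E shift_coef_i1 mpolyCN mulNr.
by case: (j != i); rewrite ?mpolyC1 ?mpolyC0.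
Qed.

Lemma Delta_1i i j : Delta_ i (Q j) = Q j - (j != i)%:R * dQ j.
Proof.
rewrite Delta_E shift_coef_1i mpolyCN mulNr.
by case: (j != i); rewrite ?mpolyC1 ?mpolyC0.
Qed.

Lemma Delta_V_i1 i j : Delta_V i (P j) = P j + (j != i)%:R * dP j.
Proof. by rewrite Delta_VE shift_coef_i1; case: (j != i); rewrite ?mpolyC1 ?mpolyC0. Qed.

Lemma Delta_V_1i i j : Delta_V i (Q j) = Q j + (j != i)%:R * dQ j.
Proof. by rewrite Delta_VE shift_coef_1i; case: (j != i); rewrite ?mpolyC1 ?mpolyC0. Qed.

Lemma anticomm_coef_i1 i j k g :
  P i * Delta_V i (Q j * Delta_ j (P k * Delta_V k g)) =
  P k * Delta_V k (Q j * Delta_ j (P i * Delta_V i g))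
  + (j == k)%:R * (P i * Delta_V i g) - (i == j)%:R * (P k * Delta_V k g).
Proof.
apply: (coef_i1_1i_i1 Delta_M Delta_VM (@Delta_K F m) (@Delta_VK F m)
  Delta_i1 Delta_V_i1 Delta_V_1i _ _ coefM_plus) => [l l' l1 n1 n2|l l' l1 h].
  (* At a variable different from both [l] and [l'] the two opposite shifts cancel. *)
  rewrite Delta_E Delta_VE shift_shift shift_coef_i1 n1 n2.
  by rewrite subrr mpolyC0 mul0r addr0.
rewrite !Delta_E !Delta_VE !shift_shift; apply: Defs.eq_shift => n; ring.
Qed.

Lemma anticomm_coef_1i i j k g :
  Q j * Delta_ j (P i * Delta_V i (Q k * Delta_ k g)) =
  Q k * Delta_ k (P i * Delta_V i (Q j * Delta_ j g))
  - (i == k)%:R * (Q j * Delta_ j g) + (i == j)%:R * (Q k * Delta_ k g).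
Proof.
apply: (coef_1i_i1_1i Delta_M Delta_VM (@Delta_K F m) (@Delta_VK F m)
  Delta_i1 Delta_1i Delta_V_1i _ _ coefM_minus) => [l l' l1 n1 n2|l l' l1 h].
  rewrite Delta_E Delta_VE shift_shift shift_coef_1i n1 n2.
  by rewrite addNr mpolyC0 mul0r addr0.
rewrite !Delta_E !Delta_VE !shift_shift; apply: Defs.eq_shift => n; ring.
Qed.

Definition Mas_action : sl F m -> polyvec F m -> polyvec F m :=
  gen_act (upper (fun i p => P i * Delta_V i p)) (lower (fun i p => Q i * Delta_ i p)).

Lemma scale_natb (b : bool) (x : A) : (b%:R : F) *: x = b%:R * x.
Proof. by case: b; rewrite ?scale1r ?mul1r // scale0r mul0r. Qed.

Lemma coef_i1_lin i : linear (fun p => P i * Delta_V i p).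
Proof. by move=> c p q; rewrite !Delta_VE shiftD shiftZ mulrDr scalerAr. Qed.

Lemma coef_1i_lin i : linear (fun p => Q i * Delta_ i p).
Proof. by move=> c p q; rewrite !Delta_E shiftD shiftZ mulrDr scalerAr. Qed.

Lemma Mas_action_i1 i (f : polyvec F m) :
  E_i1 a S i *m map_mx (Delta_V i) (f : 'cV[A]_2) = upper (fun i p => P i * Delta_V i p) i f.
Proof. by rewrite /E_i1 mul_E01 mxE. Qed.

Lemma Mas_action_1i i (f : polyvec F m) :
  E_1i a S i *m map_mx (Delta_ i) (f : 'cV[A]_2) = lower (fun i p => Q i * Delta_ i p) i f.
Proof. by rewrite /E_1i mul_E10 mxE. Qed.

Lemma Mas_exists : is_Mas a S Mas_action.
Proof.
have sts i j k p : P i * Delta_V i (Q j * Delta_ j (P k * Delta_V k p)) =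
    P k * Delta_V k (Q j * Delta_ j (P i * Delta_V i p))
    + (j == k)%:R *: (P i * Delta_V i p) - (i == j)%:R *: (P k * Delta_V k p).
  by rewrite !scale_natb; apply: anticomm_coef_i1.
have tst i j k p : Q j * Delta_ j (P i * Delta_V i (Q k * Delta_ k p)) =
    Q k * Delta_ k (P i * Delta_V i (Q j * Delta_ j p))
    - (i == k)%:R *: (Q j * Delta_ j p) + (i == j)%:R *: (Q k * Delta_ k p).
  by rewrite !scale_natb; apply: anticomm_coef_1i.
split.
- exact: (antidiagonal_umodule coef_i1_lin coef_1i_lin sts tst).
- apply: (antidiagonal_h coef_i1_lin coef_1i_lin sts tst) => i p.
    (* [Delta_V i] fixes [Q i], in which no variable other than ['X_i] occurs. *)
    by rewrite Delta_VM Delta_K Delta_V_1i eqxx mul0r addr0 mulrA coefM.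
  by rewrite Delta_M Delta_VK Delta_i1 eqxx mul0r subr0 mulrCA mulrA coefM.
- move=> i f; rewrite Mas_action_i1; apply: gen_act_i1.
- move=> i f; rewrite Mas_action_1i; apply: gen_act_1i.
Qed.

(** Uniqueness is an equality of functions, hence the appeals to extensionality; the odd generators
    agree by definition and [gen_act_unique] extends this to all of sl(m|1). *)
Lemma Mas_unique rho : is_Mas a S rho -> Mas_action = rho.
Proof.
case=> rhoP _ rho_i1 rho_1i; rewrite /Mas_action.
have -> : upper (fun i p => P i * Delta_V i p) = fun i => rho (e_i1 F i).
  do 2![apply: functional_extensionality => ?].
  by rewrite rho_i1 Mas_action_i1.
have -> : lower (fun i p => Q i * Delta_ i p) = fun i => rho (e_1i F i).
  do 2![apply: functional_extensionality => ?].
  by rewrite rho_1i Mas_action_1i.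
do 2![apply: functional_extensionality => ?].
by apply/esym/gen_act_unique.
Qed.

End MasOperators.

Theorem theorem4p8 (R : realType) (m : nat) (hm : (2 <= m)%N) :
  (forall (a : 'I_m -> R[i]) (S : {set 'I_m}), (forall i, a i != 0) ->
     exists! rho : sl R[i] m -> polyvec R[i] m -> polyvec R[i] m,
       is_Mas a S rho)
  /\
  (forall (V : lmodType R[i]) (rho : sl R[i] m -> V -> V), in_M 2 rho ->
     exists (a : 'I_m -> R[i]) (S : {set 'I_m})
            (rho' : sl R[i] m -> polyvec R[i] m -> polyvec R[i] m),
       [/\ forall i, a i != 0, is_Mas a S rho' & umod_iso rho rho']).
Proof.
split=> [a S a0|V rho rhoM].
  exists (Mas_action a S).
  by split; [exact: Mas_exists | exact: Mas_unique].
apply: rank_two_classification => //.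
by rewrite Num.Theory.pnatr_eq0.
Qed.
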